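(* Let $f \in \mathbb{Z}[X]$ be a separable polynomial. Then the decision problem $\Pi_f$ lies in the complexity class $\mathcal{NP}$.
   Context: An order is a commutative ring $A$ (with $1$) whose underlying additive group is isomorphic to $\mathbb{Z}^n$ for some $n \in \mathbb{Z}_{\geq 0}$; $n$ is called the rank of $A$. For $f \in \mathbb{Z}[X]$, $Z_A(f)$ denotes the set of zeroes of $f$ in $A$. An order is specified as input by the integer $n$ and structure constants $(a_{ijk})_{1 \le i,j,k \le n} \in \mathbb{Z}^{n^3}$ describing the multiplication on $\mathbb{Z}^n$ by $e_i \cdot e_j = \sum_{k=1}^n a_{ijk} e_k$. For a fixed $f \in \mathbb{Z}[X]$, the decision problem $\Pi_f$ is: given as input an order $A$, determine whether $Z_A(f)$ is non-empty. (The polynomial $f$ is not part of the input.) A polynomial in $\mathbb{Z}[X]$ is separable if it has no double roots in $\overline{\mathbb{Q}}$. Complexity is measured in the bit-length of the input. *)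

(* Defs.v *)
From mathcomp Require Import all_boot all_order all_algebra all_field.
Set Implicit Arguments.
Unset Strict Implicit.
Unset Printing Implicit Defensive.

Import Order.TTheory GRing.Theory Num.Theory.
Local Open Scope ring_scope.

(** * Orders and zeroes *)

(* [comPzRingType] rather than [comNzRingType]: the zero ring is the order of
   rank 0. *)
Record Zorder := ZOrder {
  Zorder_ring :> comPzRingType;
  Zorder_axiom : exists (n : nat) (phi : {additive 'rV[int]_n -> Zorder_ring}),
    bijective phi
}.

(* The value of f at x is written out because [horner] is only available over
   nonzero rings. *)
Definition is_zero_of (A : comPzRingType) (f : {poly int}) (x : A) : Prop :=
  \sum_(i < size f) x ^+ i *~ f`_i = 0.

(* Divisibility by the square also excludes f = 0, for which every algebraic
   number counts as a double root.  [algC] is an algebraic closure of Q. *)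
Definition double_root (f : {poly int}) (z : algC) : Prop :=
  ('X - z%:P) ^+ 2 %| map_poly intr f.

Definition separable_int_poly (f : {poly int}) : Prop :=
  forall z : algC, ~ double_root f z.

Definition structure_constants (n : nat) := 'I_n -> 'I_n -> 'I_n -> int.

Definition specifies (n : nat) (a : structure_constants n) (A : Zorder) : Prop :=
  exists phi : {additive 'rV[int]_n -> A},
    bijective phi /\
    (let e i : A := phi (delta_mx 0 i) in
     forall i j : 'I_n, e i * e j = \sum_(k < n) e k *~ a i j k).

(** * Encoding of the input as a bit string *)

Local Open Scope nat_scope.

(* Binary digits, least significant first, without leading zeroes: up_log 2 n.+1
   is the number of binary digits of n (none for n = 0). *)
Definition bits (n : nat) : seq bool :=
  mkseq (fun i => odd (n %/ 2 ^ i)) (up_log 2 n.+1).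

(* Self-delimiting: each digit is preceded by a continuation bit [true], and
   the code is closed by [false]. *)
Definition encode_nat (n : nat) : seq bool :=
  flatten [seq [:: true; b] | b <- bits n] ++ [:: false].

Definition encode_int (z : int) : seq bool := (z < 0)%R :: encode_nat `|z|.

Definition encode_input (n : nat) (a : structure_constants n) : seq bool :=
  encode_nat n ++
  \big[cat/[::]]_(i < n) \big[cat/[::]]_(j < n) \big[cat/[::]]_(k < n)
    encode_int (a i j k).

(** * Decision problems and NP *)

Definition language := seq bool -> Prop.

Inductive move := MoveLeft | Stay | MoveRight.

Definition symbol (W : finType) : Type := option (bool + W).

Definition blank {W : finType} : symbol W := None.
Definition bit {W : finType} (b : bool) : symbol W := Some (inl b).

(* A two-way infinite tape; [tleft] lists the cells left of the head, nearest
   first, and all cells not listed are blank. *)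
Record tape (W : finType) := Tape {
  tleft : seq (symbol W);
  thead : symbol W;
  tright : seq (symbol W)
}.

Definition write_move (W : finType) (t : tape W) (s : symbol W) (m : move) :
    tape W :=
  let: Tape l _ r := t in
  match m with
  | MoveLeft => Tape (behead l) (head blank l) (s :: r)
  | Stay => Tape l s r
  | MoveRight => Tape (s :: l) (head blank r) (behead r)
  end.

Definition input_tape (W : finType) (w : seq bool) : tape W :=
  let s := [seq bit b | b <- w] in Tape [::] (head blank s) (behead s).

(* Deterministic multitape Turing machines; [state] and [work_symbol] being
   finite, [delta] is a finite table. *)
Record turing_machine := TuringMachine {
  extra_tapes : nat;
  work_symbol : finType;
  state : finType;
  start : state;
  halting : pred state;
  accepting : pred state;
  delta : state -> {ffun 'I_extra_tapes.+2 -> symbol work_symbol} ->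
          state * ('I_extra_tapes.+2 -> symbol work_symbol * move)
}.

Section Run.

Variable M : turing_machine.
Local Notation tape_index := 'I_(extra_tapes M).+2.

Definition config : Type :=
  (state M * (tape_index -> tape (work_symbol M)))%type.

(* The two arguments are written on tapes 0 and 1, the other tapes are blank. *)
Definition initial (x u : seq bool) : config :=
  (start M, fun i : tape_index => input_tape (work_symbol M)
     match val i with 0 => x | 1 => u | _ => [::] end).

Definition step (c : config) : config :=
  let: (q, T) := c in
  if halting q then c else
  let: (q', act) := delta q [ffun i => thead (T i)] in
  (q', fun i => write_move (T i) (act i).1 (act i).2).

Definition run (t : nat) (x u : seq bool) : config :=
  iter t step (initial x u).

End Run.

Definition poly_time (R : seq bool -> seq bool -> bool) : Prop :=
  exists (M : turing_machine) (p : {poly nat}), forall x u : seq bool,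
    let q := (run M p.[(size x + size u)%N]%R x u).1 in
    halting q /\ accepting q = R x u.

Definition NP (L : language) : Prop :=
  exists (R : seq bool -> seq bool -> bool) (p : {poly nat}),
    poly_time R /\
    forall x : seq bool,
      L x <-> exists2 u : seq bool, size u <= p.[size x]%R & R x u.

(* The problem is identified with the set of codes of its yes-instances. *)
Definition root_problem (f : {poly int}) : language := fun w =>
  exists (n : nat) (a : structure_constants n) (A : Zorder),
    [/\ w = encode_input a, specifies a A & exists x : A, is_zero_of f x].

(* Main.v *)
Require Import Defs.
From mathcomp Require Import all_boot all_order all_fingroup all_algebra all_field.
From mathcomp Require Import zify.
From HB Require Import structures.
From Stdlib Require Import FunctionalExtensionality.
Set Implicit Arguments.
Unset Strict Implicit.
Unset Printing Implicit Defensive.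
Import Order.TTheory GRing.Theory Num.Theory.

(** Membership in NP needs short certificates and a fast verifier.

    Certificates.  An order with its structure constants is an integer table
    a_ijk; a certificate consists of the coordinates of the unit and of a zero
    alpha of f.  These coordinates have polynomially many digits, which is
    where separability is used.  Let M_v be the matrix of multiplication by v.
    The matrix of the trace form and the numbers tr(M_alpha M_i) are small
    integers: the latter are sums of products of eigenvalues, those of M_alpha
    being roots of f ([trace_alpha_size]).  By Cramer's rule the linear system
    with this matrix and this right-hand side has a small rational solution
    beta ([bounded_solution]).  The difference beta - alpha lies in the radical
    of the trace form, hence is nilpotent ([trace_radical_nilpotent]).  As f is
    separable, f' is invertible modulo f, and Newton's method started at beta
    reaches alpha exactly ([newton_iter]).  Each round doubles the order to
    which the nilpotent error is killed, so a logarithmic number of rounds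
    suffices and the size grows only polynomially; the coordinates of alpha are
    then read off from its multiplication matrix by a second linear system
    ([zero_size], [order_zero_size]).  The unit is a zero of X - 1, so the same
    bound applies to it.

    The verifier.  All conditions on a certificate are identities between
    iterated sums of products of its entries: commutativity, associativity,
    the unit law and f(alpha) = 0.  Even the requirement that the input be the
    code of the table becomes such a condition, by describing the code by its
    length and its digits ([ariths_flatten]) instead of parsing the input.  So it
    suffices to consider the arithmetic functions [arith] of two words, which
    are built from sums, truncated differences, products, and iterated sums and
    products over the positions of a word.  Their values have polynomially
    many digits, and schoolbook arithmetic evaluates them in polynomial time
    ([poly_time_arith]).  The programs that do so are written in a small
    language of structured programs on stacks, which is compiled to multitape
    machines, a tape serving as a stack ([exec_runs]). *)

(** * Stack programs and their compilation to Turing machines *)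

Definition store := nat -> seq bool.

Definition upd (s : store) (r : nat) (w : seq bool) : store :=
  fun i => if i == r then w else s i.

Inductive com :=
  | Skip
  | Push of nat & bool
  | Pop of nat
  | Seq of com & com
  | If of nat & com & com & com
  | While of nat & com.

Definition branch (w : seq bool) (c1 c2 c3 : com) : com :=
  if w is b :: _ then if b then c1 else c2 else c3.

(** The numbers of steps are those of the compiled machine: a push takes two,
    since the head has to reach a fresh cell before it writes. *)
Inductive exec : com -> store -> nat -> store -> Prop :=
  | ExecSkip s : exec Skip s 1 s
  | ExecPush s r b : exec (Push r b) s 2 (upd s r (b :: s r))
  | ExecPop s r : exec (Pop r) s 1 (upd s r (behead (s r)))
  | ExecSeq c1 c2 s1 s2 s3 t1 t2 :
      exec c1 s1 t1 s2 -> exec c2 s2 t2 s3 -> exec (Seq c1 c2) s1 (t1 + t2) s3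
  | ExecIf r c1 c2 c3 s s' t :
      exec (branch (s r) c1 c2 c3) s t s' -> exec (If r c1 c2 c3) s t.+1 s'
  | ExecWhileEnd r c s : s r = [::] -> exec (While r c) s 1 s
  | ExecWhile r c s1 s2 s3 t1 t2 : s1 r != [::] ->
      exec c s1 t1 s2 -> exec (While r c) s2 t2 s3 ->
      exec (While r c) s1 (t1 + t2).+1 s3.

Fixpoint maxreg (c : com) : nat :=
  match c with
  | Skip => 0
  | Push r _ | Pop r => r
  | Seq c1 c2 => maxn (maxreg c1) (maxreg c2)
  | If r c1 c2 c3 =>
      maxn r (maxn (maxreg c1) (maxn (maxreg c2) (maxreg c3)))
  | While r c => maxn r (maxreg c)
  end.

(** Built along the syntax, so that the states of a subprogram embed in those of
    the program; to leave the program is the value [None] of [transition]. *)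
Fixpoint control (c : com) : finType :=
  match c with
  | Skip | Pop _ => unit
  | Push _ _ => bool
  | Seq c1 c2 => (control c1 + control c2)%type
  | If _ c1 c2 c3 => option (control c1 + (control c2 + control c3))%type
  | While _ c => option (control c)
  end.

Fixpoint entry (c : com) : control c :=
  match c with
  | Skip => tt
  | Push _ _ => false
  | Pop _ => tt
  | Seq c1 c2 => inl (entry c1)
  | If _ c1 c2 c3 => None
  | While _ c => None
  end.

Section Compile.

Variable K : nat.
Local Notation tape_index := 'I_K.+2.
Local Notation heads := {ffun tape_index -> symbol void}.
Local Notation action := (tape_index -> symbol void * move).
Local Notation tapes := (tape_index -> tape void).

Definition idle (h : heads) : action := fun i => (h i, Stay).

Definition on_tape (h : heads) (r : nat) (a : symbol void) (m : move) : action :=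
  fun i => if val i == r then (a, m) else (h i, Stay).

Definition apply_action (T : tapes) (a : action) : tapes :=
  fun i => write_move (T i) (a i).1 (a i).2.

(** The default value of [inord] is never met, as registers are below K.+2. *)
Fixpoint transition (c : com) :
    control c -> heads -> option (control c) * action :=
  match c return control c -> heads -> option (control c) * action with
  | Skip => fun _ h => (None, idle h)
  | Push r b => fun q h =>
      if q then (None, on_tape h r (bit b) Stay)
      else (Some true, on_tape h r (h (inord r)) MoveLeft)
  | Pop r => fun _ h => (None, on_tape h r blank MoveRight)
  | Seq c1 c2 => fun q h =>
      match q with
      | inl q1 => let: (q', a) := transition q1 h in
          (Some (if q' is Some q1' then inl q1' else inr (entry c2)), a)
      | inr q2 => let: (q', a) := transition q2 h in (omap inr q', a)
      end
  | If r c1 c2 c3 => fun q h =>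
      match q with
      | None =>
          (Some (Some match h (inord r) with
                      | Some (inl true) => inl (entry c1)
                      | Some (inl false) => inr (inl (entry c2))
                      | _ => inr (inr (entry c3))
                      end), idle h)
      | Some (inl q1) => let: (q', a) := transition q1 h in
          (omap (fun q => Some (inl q)) q', a)
      | Some (inr (inl q2)) => let: (q', a) := transition q2 h in
          (omap (fun q => Some (inr (inl q))) q', a)
      | Some (inr (inr q3)) => let: (q', a) := transition q3 h in
          (omap (fun q => Some (inr (inr q))) q', a)
      end
  | While r c => fun q h =>
      match q with
      | None => (if h (inord r) is None then None else Some (Some (entry c)),
                 idle h)
      | Some q1 => let: (q', a) := transition q1 h in (Some q', a)
      end
  end.

Definition read (T : tapes) : heads := [ffun i => Defs.thead (T i)].

(** Runs that end by leaving the program, so that runs of consecutive programs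
    compose. *)
Inductive runs (c : com) : control c -> tapes -> nat -> tapes -> Prop :=
  | RunsExit q T a : transition q (read T) = (None, a) ->
      runs q T 1 (apply_action T a)
  | RunsStep q T a q' t T' : transition q (read T) = (Some q', a) ->
      runs q' (apply_action T a) t T' -> runs q T t.+1 T'.

(** The top is under the head, and blanks mark the bottom. *)
Definition holds_stack (t : tape void) (w : seq bool) : Prop :=
  (forall j, nth blank (tleft t) j = blank) /\
  (forall j, nth blank (Defs.thead t :: tright t) j = nth blank [seq bit b | b <- w] j).

Definition represents (T : tapes) (s : store) : Prop :=
  forall i : tape_index, holds_stack (T i) (s i).

Lemma write_move_stay (t : tape void) : write_move t (Defs.thead t) Stay = t.
Proof. by case: t. Qed.

Lemma apply_idle T : apply_action T (idle (read T)) = T.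
Proof.
by apply: functional_extensionality => i; rewrite /apply_action /= ffunE write_move_stay.
Qed.

Lemma represents_on_tape T s r a m w :
    represents T s ->
    (forall t, holds_stack t (s r) -> holds_stack (write_move t a m) w) ->
  represents (apply_action T (on_tape (read T) r a m)) (upd s r w).
Proof.
move=> Ts H i; rewrite /apply_action /on_tape /upd.
case: eqP => [er|_] /=; last by rewrite ffunE write_move_stay.
by apply: H; rewrite -er.
Qed.

Lemma read_top T s r : r < K.+2 -> represents T s ->
  read T (inord r) = nth blank [seq bit b | b <- s r] 0.
Proof.
by move=> ltr /(_ (inord r))[_ /(_ 0)]; rewrite inordK // => <-; rewrite ffunE.
Qed.

Lemma holds_push t w b : holds_stack t w ->
  holds_stack (write_move (write_move t (Defs.thead t) MoveLeft) (bit b) Stay) (b :: w).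
Proof.
case: t => [l h r] [/= Hl Hr]; split=> [j|[|j]] //=.
by rewrite nth_behead.
Qed.

Lemma holds_pop t w : holds_stack t w -> holds_stack (write_move t blank MoveRight) (behead w).
Proof.
case: t => [l h r] [/= Hl Hr]; split=> j; first by case: j => [|j] /=.
rewrite /=.
have -> : nth blank (head blank r :: behead r) j = nth blank (h :: r) j.+1.
  by case: j => [|j] /=; rewrite ?nth_behead //; case: (r).
by rewrite Hr; case: (w) => //=; rewrite !nth_nil.
Qed.

Lemma runs_embed c c' (g : control c -> control c') q T t T' :
    (forall q h, transition (g q) h =
       (omap g (transition q h).1, (transition q h).2)) ->
  runs q T t T' -> runs (g q) T t T'.
Proof.
move=> Hg; elim=> {q T t T'} [q T a E|q T a q' t T' E _ IH].
  by apply: RunsExit; rewrite Hg E.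
by apply: RunsStep IH; rewrite Hg E.
Qed.

Lemma runs_seq1 c1 c2 q T t T' t2 T'' :
    @runs c1 q T t T' -> @runs c2 (entry c2) T' t2 T'' ->
  @runs (Seq c1 c2) (inl q) T (t + t2) T''.
Proof.
have E2 q2 h : @transition (Seq c1 c2) (inr q2) h =
    (omap inr (transition q2 h).1, (transition q2 h).2).
  by rewrite /=; case: (transition q2 h).
move=> R1 /(@runs_embed _ (Seq c1 c2) inr _ _ _ _ E2) R2.
elim: R1 R2 => {q T t T'} [q T a E|q T a q' t T' E _ IH] R2.
  by rewrite add1n; apply: (@RunsStep (Seq c1 c2) _ _ a (inr (entry c2))) R2; rewrite /= E.
by rewrite addSn; apply: (@RunsStep (Seq c1 c2) _ _ a (inl q')) (IH R2); rewrite /= E.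
Qed.

Lemma runs_while r c q T t T' t2 T'' :
    @runs c q T t T' -> @runs (While r c) None T' t2 T'' ->
  @runs (While r c) (Some q) T (t + t2) T''.
Proof.
move=> R1 R2; elim: R1 R2 => {q T t T'} [q T a E|q T a q' t T' E _ IH] R2.
  by rewrite add1n; apply: (@RunsStep (While r c) _ _ a None) R2; rewrite /= E.
by rewrite addSn; apply: (@RunsStep (While r c) _ _ a (Some q')) (IH R2); rewrite /= E.
Qed.

(** Every tape is used as a stack: its head stays on the top, and what lies to
    the left has been blanked, so popping is a step to the right and pushing a
    step to the left followed by a write. *)
Theorem exec_runs c s t s' : exec c s t s' -> maxreg c < K.+2 ->
  forall T, represents T s ->
  exists2 T', @runs c (entry c) T t T' & represents T' s'.
Proof.
elim=> {c s t s'}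
  [s|s r b|s r|c1 c2 s1 s2 s3 t1 t2 _ IH1 _ IH2|r c1 c2 c3 s s' t _ IH
  |r c s E|r c s1 s2 s3 t1 t2 E _ IH1 _ IH2] /= ltc T HT.
- exists T => //; rewrite -{2}(apply_idle T); exact: RunsExit.
- pose T1 := apply_action T (on_tape (read T) r (read T (inord r)) MoveLeft).
  exists (apply_action T1 (on_tape (read T1) r (bit b) Stay)).
    by apply: (@RunsStep (Push r b) _ _ _ true) => //; apply: RunsExit.
  move=> i; rewrite {1}/apply_action /on_tape.
  have Hi := HT i; case: eqP => [er|/eqP ner] /=; rewrite /upd.
    rewrite -er eqxx; have -> : T1 i = write_move (T i) (Defs.thead (T i)) MoveLeft.
      rewrite /T1 /apply_action /on_tape -er eqxx /= ffunE.
      congr (write_move _ (Defs.thead (T _)) _).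
      by apply: val_inj; rewrite /= inordK.
    exact: holds_push.
  rewrite (negPf ner) ffunE write_move_stay /T1 /apply_action /on_tape (negPf ner) /=.
  by rewrite ffunE write_move_stay.
- exists (apply_action T (on_tape (read T) r blank MoveRight)).
    exact: RunsExit.
  by apply: represents_on_tape => // t; apply: holds_pop.
- move: ltc; rewrite gtn_max => /andP[lt1 lt2].
  have [T1 R1 H1] := IH1 lt1 _ HT; have [T2 R2 H2] := IH2 lt2 _ H1.
  by exists T2 => //; apply: runs_seq1 R2.
- move: ltc; rewrite !gtn_max => /and4P[ltr lt1 lt2 lt3].
  have ltb : maxreg (branch (s r) c1 c2 c3) < K.+2 by case: (s r) => [|[] ?].
  have [T' R' HT'] := IH ltb _ HT; exists T' => //.
  have E := read_top ltr HT.
  have := apply_idle T; set a := idle _ => Ea.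
  case Es: (s r) E R' => [|b w] /= E R'; last case: b Es E R' => Es E R'.
  + apply: (@RunsStep (If r c1 c2 c3) _ _ _ (Some (inr (inr (entry c3))))).
      by rewrite /= E.
    rewrite Ea; apply: (@runs_embed _ (If r c1 c2 c3) (fun q => Some (inr (inr q)))) R'.
    by move=> q h /=; case: (transition q h).
  + apply: (@RunsStep (If r c1 c2 c3) _ _ _ (Some (inl (entry c1)))).
      by rewrite /= E.
    rewrite Ea; apply: (@runs_embed _ (If r c1 c2 c3) (fun q => Some (inl q))) R'.
    by move=> q h /=; case: (transition q h).
  + apply: (@RunsStep (If r c1 c2 c3) _ _ _ (Some (inr (inl (entry c2))))).
      by rewrite /= E.
    rewrite Ea; apply: (@runs_embed _ (If r c1 c2 c3) (fun q => Some (inr (inl q)))) R'.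
    by move=> q h /=; case: (transition q h).
- move: ltc; rewrite gtn_max => /andP[ltr _].
  exists T => //; rewrite -{2}(apply_idle T); apply: RunsExit => /=.
  by rewrite (read_top ltr HT) E.
- move: (ltc); rewrite gtn_max => /andP[ltr lt1].
  have [T1 R1 H1] := IH1 lt1 _ HT; have [T2 R2 H2] := IH2 ltc _ H1.
  exists T2 => //; apply: (@RunsStep (While r c) _ _ _ (Some (entry c))).
    by rewrite /= (read_top ltr HT); case: (s1 r) E.
  by rewrite apply_idle; apply: runs_while R2.
Qed.

End Compile.

Lemma iter_halted (M : turing_machine) (q : state M) T t : halting q ->
  iter t (@step M) (q, T) = (q, T).
Proof. by move=> hq; elim: t => //= t ->; rewrite /step hq. Qed.

Section Machine.

Variables (c : com) (r : nat).

(** Once the program is left, one more step reads the answer on tape r. *)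
Definition machine_of : turing_machine :=
  let K := maxn (maxreg c) r in
  @TuringMachine K void (control c + option bool)%type (inl (entry c))
    (fun q => if q is inr (Some _) then true else false)
    (fun q => if q is inr (Some b) then b else false)
    (fun q h => match q with
      | inl q => let: (q', a) := transition q h in
          (if q' is Some q' then inl q' else inr None, a)
      | inr _ => (inr (Some (h (inord r) == bit true)), idle h)
      end).

Definition initial_store (x u : seq bool) : store :=
  fun i => match i with 0 => x | 1 => u | _ => [::] end.

Lemma runs_iter q T t T' : @runs _ c q T t T' ->
  iter t (@step machine_of) (inl q, T) = (inr None, T').
Proof.
elim=> {q T t T'} [q T a E|q T a q' t T' E _ IH]; last rewrite iterSr; rewrite /= E //.
Qed.

Lemma represents_initial x u :
  represents (initial machine_of x u).2 (initial_store x u).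
Proof.
move=> i; split=> [j|j] /=; first by rewrite nth_nil.
rewrite /initial_store; case: (val i) => [|[|k]]; [case: x|case: u|] => //=.
all: by case: j => [|[|j]].
Qed.

Lemma machine_of_run x u t s' t' : exec c (initial_store x u) t s' -> t < t' ->
  (run machine_of t' x u).1 = inr (Some (ohead (s' r) == Some true)).
Proof.
move=> E lt_t; have ltc : maxreg c < (maxn (maxreg c) r).+2 by lia.
have ltr : r < (maxn (maxreg c) r).+2 by lia.
have [T' R' HT'] := exec_runs E ltc (represents_initial x u).
have Ei : iter t (@step machine_of) (initial machine_of x u) = (inr None, T').
  exact: (runs_iter R').
rewrite /run -(subnK lt_t) iterD iterS Ei /step /= iter_halted //.
by rewrite (read_top ltr HT'); case: (s' r) => [|[]].
Qed.

End Machine.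

Lemma poly_time_program (R : seq bool -> seq bool -> bool) c r (p : {poly nat}) :
    (forall x u, exists t s', [/\ exec c (initial_store x u) t s',
       t <= p.[(size x + size u)%N]%R & (ohead (s' r) == Some true) = R x u]) ->
  poly_time R.
Proof.
move=> H; exists (machine_of c r), (p + 1%:P)%R => x u.
have [t [s' [E le_t <-]]] := H x u.
have Ep k : (p + 1%:P)%R.[k]%R = p.[k]%R.+1 by rewrite hornerD hornerC; apply: addn1.
by rewrite (machine_of_run (t' := (p + 1%:P).[_]%R) r E) // Ep ltnS.
Qed.

(** * Binary numbers on stacks *)

Definition value (w : seq bool) : nat := foldr (fun (b : bool) v => b + v.*2) 0 w.

Lemma bits0 : bits 0 = [::]. Proof. by rewrite /bits up_log1. Qed.

(** Codes have no leading zeroes, so 0 needs a case of its own. *)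
Lemma bitsS (b : bool) v :
  bits (b + v.*2) = if b + v.*2 == 0 then [::] else b :: bits v.
Proof.
case: eqP => [-> | /eqP nz]; first exact: bits0.
rewrite /bits up_log2S ?lt0n // half_bit_double /mkseq /= expn0 divn1.
rewrite oddD odd_double oddb addbF; congr (_ :: _).
rewrite -[1]/(1 + 0)%N iotaDl -map_comp; apply: eq_map => i /=.
by rewrite add1n expnS divnMA divn2 half_bit_double.
Qed.

Lemma bits1 : bits 1 = [:: true].
Proof. by rewrite (bitsS true 0) bits0. Qed.

Lemma bits_ind (P : nat -> Prop) : P 0 ->
  (forall (b : bool) v, b + v.*2 != 0 -> P v -> P (b + v.*2)) -> forall v, P v.
Proof.
move=> P0 PS; elim/ltn_ind=> v IH; case: (posnP v) => [-> //|v_gt0].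
rewrite -(odd_double_half v); apply: PS; first by rewrite odd_double_half -lt0n.
by apply: IH; lia.
Qed.

Lemma value_bits v : value (bits v) = v.
Proof.
elim/bits_ind: v => [|b v nz IH]; first by rewrite bits0.
by rewrite bitsS (negPf nz) /= IH.
Qed.

Lemma bits_eq_nil v : (bits v == [::]) = (v == 0).
Proof.
elim/bits_ind: v => [|b v nz _]; first by rewrite bits0.
by rewrite bitsS (negPf nz).
Qed.

Lemma size_bits v : size (bits v) = up_log 2 v.+1.
Proof. exact: size_mkseq. Qed.

Lemma size_bits_le v L : v < 2 ^ L -> size (bits v) <= L.
Proof. by rewrite size_bits; apply: up_log_min. Qed.

Lemma lt_size_bits v : v < 2 ^ size (bits v).
Proof. by rewrite size_bits; apply: up_logP. Qed.

Lemma value_rcons w b : value (rcons w b) = value w + b * 2 ^ size w.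
Proof.
by elim: w => [|c w IH] /=; rewrite ?expn0 ?muln1 ?addn0 // IH expnS; lia.
Qed.

Lemma value_take_nth A k :
  value (take k.+1 A) = value (take k A) + nth false A k * 2 ^ k.
Proof.
case: (ltnP k (size A)) => [lt_k|le_k].
  by rewrite (take_nth false) // value_rcons size_take lt_k.
by rewrite nth_default // mul0n addn0 !take_oversize // ltnW.
Qed.

(** * Running time of programs *)

(** Exact running times would depend on the contents of the stacks; upper bounds
    depend on their sizes only. *)
Definition within (c : com) (s : store) (t : nat) (s' : store) : Prop :=
  exists2 t', t' <= t & exec c s t' s'.

Lemma within_le c s t1 t2 s' : within c s t1 s' -> t1 <= t2 -> within c s t2 s'.
Proof. by case=> t' le_t' E le_t; exists t' => //; apply: leq_trans le_t. Qed.

Lemma within_skip s : within Skip s 1 s.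
Proof. by exists 1 => //; apply: ExecSkip. Qed.

Lemma within_push s r b : within (Push r b) s 2 (upd s r (b :: s r)).
Proof. by exists 2 => //; apply: ExecPush. Qed.

Lemma within_pop s r : within (Pop r) s 1 (upd s r (behead (s r))).
Proof. by exists 1 => //; apply: ExecPop. Qed.

Lemma within_seq c1 c2 s1 t1 s2 t2 s3 :
  within c1 s1 t1 s2 -> within c2 s2 t2 s3 -> within (Seq c1 c2) s1 (t1 + t2) s3.
Proof.
move=> [t1' le1 E1] [t2' le2 E2]; exists (t1' + t2'); first exact: leq_add.
exact: ExecSeq E2.
Qed.

Lemma within_if r c1 c2 c3 s t s' :
  within (branch (s r) c1 c2 c3) s t s' -> within (If r c1 c2 c3) s t.+1 s'.
Proof. by case=> t' le_t E; exists t'.+1 => //; apply: ExecIf. Qed.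

(** The loop empties the stack r one bit per round; [inv k] is the store after
    k rounds. *)
Lemma within_while r c w (inv : nat -> store) t :
    (forall k, k <= size w -> inv k r = drop k w) ->
    (forall k, k < size w -> within c (inv k) t (inv k.+1)) ->
  within (While r c) (inv 0) (size w * t.+1).+1 (inv (size w)).
Proof.
move=> inv_r step.
suff loop n k : k + n = size w ->
    within (While r c) (inv k) (n * t.+1).+1 (inv (size w)) by exact: loop.
elim: n k => [|n IH] k; rewrite ?addn0 => Ek.
  rewrite -{1}Ek; exists 1 => //; rewrite Ek; apply: ExecWhileEnd.
  by rewrite inv_r // drop_size.
have ltk : k < size w by lia.
have [t1 le1 E1] := step _ ltk; have [|t2 le2 E2] := IH k.+1; first by lia.
exists (t1 + t2).+1; first by lia.
apply: ExecWhile E1 E2; rewrite inv_r 1?ltnW //.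
by rewrite -size_eq0 size_drop subn_eq0 -ltnNge.
Qed.

Definition pop_if (r : nat) (f : option bool -> com) : com :=
  If r (Seq (Pop r) (f (Some true))) (Seq (Pop r) (f (Some false))) (f None).

Lemma within_pop_if r f s t s' :
  within (f (ohead (s r))) (upd s r (behead (s r))) t s' ->
  within (pop_if r f) s t.+2 s'.
Proof.
move=> H; apply: within_if; have P := within_pop s r.
case Er: (s r) H P => [|[] w] /= H P; try exact: within_seq P H.
case: H => t' le_t' E; exists t'; first exact: leqW.
congr exec: E; apply: functional_extensionality => i.
by rewrite /upd; case: eqP => // ->.
Qed.

Lemma upd_same s r w : upd s r w r = w.
Proof. by rewrite /upd eqxx. Qed.

(* Decides register equalities by linear arithmetic. *)
Ltac regs := rewrite /upd; repeat match goal with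
  | |- context [?a == ?b :> nat] =>
    first [ rewrite (_ : (a == b) = true); [|by lia]
          | rewrite (_ : (a == b) = false); [|by lia] ]
  end; try done.

Ltac stores := apply: functional_extensionality => ?; rewrite /upd;
  repeat case: eqP => ?; subst; try done; try lia.

(** * Arithmetic macros *)

Definition reverse_onto (a z : nat) : com :=
  While a (pop_if a (fun b => if b is Some b then Push z b else Skip)).

Lemma within_reverse_onto a z s : a != z ->
  within (reverse_onto a z) s (size (s a) * 5).+1
    (upd (upd s a [::]) z (catrev (s a) (s z))).
Proof.
move=> az.
pose inv k := upd (upd s a (drop k (s a))) z (catrev (take k (s a)) (s z)).
have -> : s = inv 0 by rewrite /inv take0 drop0; stores.
have -> : upd (upd (inv 0) a [::]) z (catrev (inv 0 a) (inv 0 z)) = inv (size (inv 0 a)).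
  have -> : inv 0 a = s a by rewrite /inv drop0; regs.
  have -> : inv 0 z = s z by rewrite /inv take0; regs.
  by rewrite /inv drop_size take_size; stores.
have -> : inv 0 a = s a by rewrite /inv drop0; regs.
apply: within_while => k ltk; first by rewrite /inv; regs.
apply: within_pop_if.
have -> : inv k a = drop k (s a) by rewrite /inv; regs.
rewrite (drop_nth false) //=; set b := nth _ _ _.
apply: eq_rect (within_push _ _ _) _ _.
have -> : upd (inv k) a (drop k.+1 (s a)) z = catrev (take k (s a)) (s z).
  by rewrite /inv; regs.
rewrite /inv (take_nth false) // -cats1 catrev_catl /=; stores.
Qed.

(** The most significant digit comes first, so the leading zeroes are those
    which meet an empty target.  Without leading zeroes the height of a stack is
    governed by its value, which keeps iterated products polynomial. *)
Definition trim_onto (z a : nat) : com :=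
  While z (pop_if z (fun b => match b with
    | Some true => Push a true
    | Some false => If a (Push a false) (Push a false) Skip
    | None => Skip
    end)).

Lemma within_trim_onto z a s : a != z -> s a = [::] ->
  within (trim_onto z a) s (size (s z) * 6).+1
    (upd (upd s z [::]) a (bits (value (rev (s z))))).
Proof.
move=> az sa.
pose inv k := upd (upd s z (drop k (s z))) a (bits (value (rev (take k (s z))))).
have -> : s = inv 0.
  by rewrite /inv take0 drop0 /= bits0; stores; rewrite sa.
have E : inv 0 z = s z by rewrite /inv drop0; regs.
rewrite E.
have -> : upd (upd (inv 0) z [::]) a (bits (value (rev (s z)))) = inv (size (s z)).
  by rewrite /inv drop_size take_size; stores.
apply: within_while => k ltk; first by rewrite /inv; regs.
apply: within_pop_if.
have -> : inv k z = drop k (s z) by rewrite /inv; regs.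
rewrite (drop_nth false) //=.
have Ek1 : bits (value (rev (take k.+1 (s z)))) =
    bits (nth false (s z) k + (value (rev (take k (s z)))).*2).
  by rewrite (take_nth false) // rev_rcons.
set v := value (rev (take k (s z))) in Ek1 *.
set b := nth _ _ _ in Ek1 *.
set s1 := upd (inv k) z _.
have s1a : s1 a = bits v by rewrite /s1 /inv /v; regs.
have Es : inv k.+1 = upd s1 a (bits (b + v.*2)).
  by rewrite /s1 /inv Ek1; stores.
have P b' : within (Push a b') s1 2 (upd s1 a (b' :: bits v)).
  by rewrite -s1a; apply: within_push.
rewrite Es; case: b {Es Ek1}; rewrite bitsS /=.
  by apply: within_le (P true) _.
apply: within_if; rewrite s1a add0n double_eq0; have := bits_eq_nil v.
case: (v == 0) => [/eqP Ev|]; last first.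
  by have := P false; case: (bits v) => [|[] w] //= Pw _; apply: within_le Pw _.
have -> : upd s1 a [::] = s1 by stores; rewrite s1a Ev.
by rewrite Ev; apply: within_le (within_skip _) _.
Qed.

(** The scratch stack z reverses the bits twice. *)
Definition copy_com (a d z : nat) : com :=
  Seq (reverse_onto a z)
    (While z (pop_if z (fun b => if b is Some b then Seq (Push a b) (Push d b)
                                 else Skip))).

Lemma within_copy a d z s : a != d -> a != z -> d != z ->
    s d = [::] -> s z = [::] ->
  within (copy_com a d z) s (size (s a) * 13).+2 (upd s d (s a)).
Proof.
move=> ad az dz sd sz.
pose w := rev (s a).
pose inv k := upd (upd (upd s a (catrev (take k w) [::])) d
   (catrev (take k w) [::])) z (drop k w).
have R := within_reverse_onto s az.
have E0 : upd (upd s a [::]) z (catrev (s a) (s z)) = inv 0.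
  by rewrite /inv take0 drop0 sz /=; stores.
rewrite {}E0 in R.
have E1 : inv (size w) = upd s d (s a).
  rewrite /inv take_size drop_size -/(rev w) /w revK; stores; exact/eqP.
have L : within (While z (pop_if z (fun b => if b is Some b then Seq (Push a b) (Push d b)
                                 else Skip))) (inv 0) (size w * 7).+1 (inv (size w)).
  apply: within_while => k ltk; first by rewrite /inv; regs.
  apply: within_pop_if.
  have -> : inv k z = drop k w by rewrite /inv; regs.
  rewrite (drop_nth false) //=; set b := nth _ _ _; set s1 := upd _ _ _.
  have := within_seq (within_push s1 a b) (within_push _ d b).
  congr within; rewrite /s1 /inv (take_nth false) // -cats1 catrev_catl /=; stores.
rewrite -E1; apply: within_le (within_seq R L) _.
by rewrite /w size_rev; lia.
Qed.

Section Ripple.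

(* [f x y c] is the output digit and the next carry for input digits x, y and
   carry c. *)
Variable f : bool -> bool -> bool -> bool * bool.

Fixpoint carry (A B : seq bool) (k : nat) : bool :=
  if k is k'.+1 then (f (nth false A k') (nth false B k') (carry A B k')).2
  else false.

Definition out (A B : seq bool) (k : nat) : bool :=
  (f (nth false A k) (nth false B k) (carry A B k)).1.

Definition ripple_step (a b z : nat) : com :=
  pop_if a (fun x => pop_if b (fun y => pop_if z.+1 (fun c =>
    let: (o, c') := f (odflt false x) (odflt false y) (odflt false c) in
    Seq (Push z o) (if c' then Push z.+1 true else Skip)))).

(** z receives the output digits in reverse, z.+1 holds a nonzero carry. *)
Definition ripple (a b z : nat) : com :=
  Seq (While a (ripple_step a b z)) (While b (ripple_step a b z)).

Definition ripple_inv (a b z : nat) (A B : seq bool) (s : store) (k : nat) :=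
  upd (upd (upd (upd s a (drop k A)) b (drop k B)) z (rev (mkseq (out A B) k)))
    z.+1 (nseq (carry A B k) true).

Lemma ohead_drop (A : seq bool) k : odflt false (ohead (drop k A)) = nth false A k.
Proof. by rewrite -(addn0 k) -nth_drop addn0; case: (drop k A). Qed.

Lemma within_ripple_step a b z A B s k : a != b -> a < z -> b < z ->
  within (ripple_step a b z) (ripple_inv a b z A B s k) 10
    (ripple_inv a b z A B s k.+1).
Proof.
move=> ab az bz; set s0 := ripple_inv _ _ _ _ _ _ _.
apply: within_pop_if; apply: within_pop_if; apply: within_pop_if.
have -> : s0 a = drop k A by rewrite /s0 /ripple_inv; regs.
set s1 := upd _ _ _; have -> : s1 b = drop k B by rewrite /s1 /s0 /ripple_inv; regs.
set s2 := upd _ _ _.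
have -> : s2 z.+1 = nseq (carry A B k) true by rewrite /s2 /s1 /s0 /ripple_inv; regs.
set s3 := upd _ _ _.
rewrite !ohead_drop.
have -> : odflt false (ohead (nseq (carry A B k) true)) = carry A B k by case: carry.
have Ef : f (nth false A k) (nth false B k) (carry A B k) =
  (out A B k, carry A B k.+1) by rewrite /= /out; case: f.
rewrite Ef.
have s3z : s3 z = rev (mkseq (out A B) k).
  by rewrite /s3 /s2 /s1 /s0 /ripple_inv; regs.
have P := within_push s3 z (out A B k); rewrite s3z in P.
have E : upd (upd s3 z (out A B k :: rev (mkseq (out A B) k))) z.+1
    (nseq (carry A B k.+1) true) = ripple_inv a b z A B s k.+1.
  rewrite /s3 /s2 /s1 /s0 /ripple_inv mkseqS rev_rcons -!drop1 !drop_drop !add1n.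
  by stores.
rewrite -E; set s4 := upd s3 z _ in P *.
have s4c : s4 z.+1 = [::].
  by rewrite /s4 /s3; regs; case: carry.
case: (carry A B k.+1) => /=.
  have := within_push s4 z.+1 true; rewrite s4c => P2.
  exact: within_le (within_seq P P2) _.
have -> : upd s4 z.+1 [::] = s4 by stores; rewrite s4c.
by apply: within_le (within_seq P (within_skip _)) _.
Qed.

Lemma within_ripple a b z A B s : a != b -> a < z -> b < z ->
    s a = A -> s b = B -> s z = [::] -> s z.+1 = [::] ->
  exists2 k, size A <= k /\ size B <= k /\ k <= maxn (size A) (size B) &
    within (ripple a b z) s ((size A + size B) * 11 + 2)
      (ripple_inv a b z A B s k).
Proof.
move=> ab az bz sa sb sz sc.
have s0 : ripple_inv a b z A B s 0 = s.
  rewrite /ripple_inv !drop0 /=; stores; congruence.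
pose kB := size (drop (size A) B).
have EkB : kB = size B - size A by rewrite /kB size_drop.
exists (size A + kB); first by lia.
have L1 : within (While a (ripple_step a b z)) s (size A * 11).+1
    (ripple_inv a b z A B s (size A)).
  rewrite -{1}s0; apply: within_while => k _.
    by rewrite /ripple_inv; regs.
  exact: within_ripple_step.
have L2 : within (While b (ripple_step a b z)) (ripple_inv a b z A B s (size A))
    (kB * 11).+1 (ripple_inv a b z A B s (size A + kB)).
  rewrite -{1}(addn0 (size A)).
  apply: (within_while (inv := fun k => ripple_inv a b z A B s (size A + k))) => k _.
    by rewrite /ripple_inv drop_drop addnC; regs.
  by rewrite addnS; apply: within_ripple_step.
apply: within_le (within_seq L1 L2) _; lia.
Qed.

End Ripple.

Definition full_adder (x y c : bool) : bool * bool :=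
  (x (+) y (+) c, [|| x && y, x && c | y && c]).

Definition full_subtractor (x y c : bool) : bool * bool :=
  (x (+) y (+) c, [|| ~~ x && y, ~~ x && c | y && c]).

(** The digits written so far, completed by the carry, make up the sum of the
    digits read so far. *)
Lemma value_adder A B k :
  value (take k A) + value (take k B) =
  value (mkseq (out full_adder A B) k) + carry full_adder A B k * 2 ^ k.
Proof.
elim: k => [|k IH]; first by rewrite !take0.
rewrite !value_take_nth mkseqS value_rcons size_mkseq expnS [out _ A B k]/out /=.
move: IH; case: (nth _ A k); case: (nth _ B k); case: (carry _ _ _ k) => /=; lia.
Qed.

(** Subtraction by hand; a final borrow tells that the difference is negative. *)
Lemma value_subtractor A B k :
  value (take k A) + carry full_subtractor A B k * 2 ^ k =
  value (take k B) + value (mkseq (out full_subtractor A B) k).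
Proof.
elim: k => [|k IH]; first by rewrite !take0.
rewrite !value_take_nth mkseqS value_rcons size_mkseq expnS [out _ A B k]/out /=.
move: IH; case: (nth _ A k); case: (nth _ B k); case: (carry _ _ _ k) => /=; lia.
Qed.

Lemma value_lt w : value w < 2 ^ size w.
Proof. by elim: w => //= b w IH; rewrite expnS; case: b; lia. Qed.

(** In the arithmetic macros a and b are the operands, the result replaces a,
    b is emptied, and the stacks from z on are scratch space. *)
Definition add_com (a b z : nat) : com :=
  Seq (ripple full_adder a b z)
    (Seq (pop_if z.+1 (fun c => if c is Some _ then Push z true else Skip))
      (trim_onto z a)).

Lemma within_add a b z s x y : a != b -> a < z -> b < z ->
    s a = bits x -> s b = bits y -> s z = [::] -> s z.+1 = [::] ->
  within (add_com a b z) s ((size (bits x) + size (bits y)) * 17 + 13)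
    (upd (upd s a (bits (x + y))) b [::]).
Proof.
move=> ab az bz sa sb sz sc.
have [k [leA [leB le_k]]] := within_ripple full_adder ab az bz sa sb sz sc.
have := value_adder (bits x) (bits y) k.
rewrite !take_oversize // !value_bits => Exy.
set s1 := ripple_inv _ _ _ _ _ _ _ _ => R.
pose o := mkseq (out full_adder (bits x) (bits y)) k.
pose w := if carry full_adder (bits x) (bits y) k then true :: rev o else rev o.
have Ew : value (rev w) = x + y.
  rewrite Exy /w; case: carry; rewrite /= ?rev_cons revK ?mul0n ?addn0 //.
  by rewrite value_rcons size_mkseq.
have Sw : size w <= k.+1 by rewrite /w; case: carry; rewrite /= size_rev size_mkseq.
have s1a : s1 a = [::] by rewrite /s1 /ripple_inv; regs; rewrite drop_oversize.
have s1z : s1 z = rev o by rewrite /s1 /ripple_inv; regs.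
have s1c : s1 z.+1 = nseq (carry full_adder (bits x) (bits y) k) true.
  by rewrite /s1 /ripple_inv; regs.
pose s2 := upd (upd s1 z.+1 [::]) z w.
have C : within (pop_if z.+1 (fun c => if c is Some _ then Push z true else Skip))
    s1 4 s2.
  apply: within_pop_if; rewrite s1c /s2 /w.
  case: carry => /=; have -> : rev o = upd s1 z.+1 [::] z by regs.
    exact: within_push.
  have <- : upd s1 z.+1 [::] = upd (upd s1 z.+1 [::]) z (upd s1 z.+1 [::] z) by stores.
  exact: within_le (within_skip _) _.
have T := @within_trim_onto z a s2 _ _.
have s2z : s2 z = w by rewrite /s2; regs.
rewrite s2z Ew in T.
have E : upd (upd s2 z [::]) a (bits (x + y)) = upd (upd s a (bits (x + y))) b [::].
  rewrite /s2 /s1 /ripple_inv (drop_oversize leA) (drop_oversize leB).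
  by stores.
rewrite -E; apply: within_le (within_seq R (within_seq C (T _ _))) _; try lia.
by rewrite /s2; regs.
Qed.

Definition sub_com (a b z : nat) : com :=
  Seq (ripple full_subtractor a b z)
    (Seq (pop_if z.+1 (fun c => if c is Some _ then While z (Pop z) else Skip))
      (trim_onto z a)).

Lemma within_clear z s : within (While z (Pop z)) s (size (s z) * 2).+1 (upd s z [::]).
Proof.
pose inv k := upd s z (drop k (s z)).
have E0 : s = inv 0 by rewrite /inv drop0; stores.
have -> : upd s z [::] = inv (size (s z)) by rewrite /inv drop_size.
rewrite {1}E0; clear E0.
apply: within_while => k ltk; first by rewrite /inv upd_same.
have -> : inv k.+1 = upd (inv k) z (behead (inv k z)); last exact: within_pop.
by rewrite {3}/inv upd_same -drop1 drop_drop add1n /inv; stores.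
Qed.

Lemma within_sub a b z s x y : a != b -> a < z -> b < z ->
    s a = bits x -> s b = bits y -> s z = [::] -> s z.+1 = [::] ->
  within (sub_com a b z) s ((size (bits x) + size (bits y)) * 19 + 13)
    (upd (upd s a (bits (x - y))) b [::]).
Proof.
move=> ab az bz sa sb sz sc.
have [k [leA [leB le_k]]] := within_ripple full_subtractor ab az bz sa sb sz sc.
have := value_subtractor (bits x) (bits y) k.
rewrite !take_oversize // !value_bits => Exy.
set s1 := ripple_inv _ _ _ _ _ _ _ _ => R.
pose o := mkseq (out full_subtractor (bits x) (bits y)) k.
pose w := if carry full_subtractor (bits x) (bits y) k then [::] else rev o.
have Ew : value (rev w) = x - y.
  have := value_lt o; rewrite size_mkseq; move: Exy; rewrite /w -/o.
  by case: carry; rewrite /= ?revK; lia.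
have Sw : size w <= k by rewrite /w; case: carry; rewrite /= ?size_rev ?size_mkseq.
have s1z : s1 z = rev o by rewrite /s1 /ripple_inv; regs.
have s1c : s1 z.+1 = nseq (carry full_subtractor (bits x) (bits y) k) true.
  by rewrite /s1 /ripple_inv; regs.
pose s2 := upd (upd s1 z.+1 [::]) z w.
have C : within (pop_if z.+1 (fun c => if c is Some _ then While z (Pop z) else Skip))
    s1 (k * 2).+3 s2.
  apply: within_pop_if; rewrite s1c /s2 /w.
  case: carry => /=; last first.
    have <- : upd s1 z.+1 [::] = upd (upd s1 z.+1 [::]) z (rev o).
      by rewrite -s1z; stores.
    exact: within_le (within_skip _) _.
  apply: within_le (within_clear _ _) _.
  have -> : upd s1 z.+1 [::] z = rev o by regs.
  by rewrite size_rev size_mkseq.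
have T := @within_trim_onto z a s2 _ _.
have s2z : s2 z = w by rewrite /s2; regs.
rewrite s2z Ew in T.
have E : upd (upd s2 z [::]) a (bits (x - y)) = upd (upd s a (bits (x - y))) b [::].
  rewrite /s2 /s1 /ripple_inv (drop_oversize leA) (drop_oversize leB).
  by stores.
rewrite -E; apply: within_le (within_seq R (within_seq C (T _ _))) _; try lia.
by rewrite /s2 /s1 /ripple_inv; regs; rewrite drop_oversize.
Qed.

Definition double_com (z : nat) : com := If z (Push z false) (Push z false) Skip.

Lemma within_double z s v : s z = bits v ->
  within (double_com z) s 3 (upd s z (bits v.*2)).
Proof.
move=> sz; apply: within_if; have := bits_eq_nil v; rewrite sz.
case: (posnP v) sz => [-> sz /eqP Ev|v_gt0 sz nb].
  have -> : upd s z (bits 0.*2) = s by stores; rewrite sz.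
  by rewrite Ev; apply: within_le (within_skip _) _.
have P := within_push s z false.
move: (bitsS false v); rewrite add0n double_eq0 gtn_eqF // => ->.
by rewrite sz in P; case: (bits v) P nb => [|[] w] P.
Qed.

(** Horner's scheme: z accumulates the product while the digits of the first
    factor are read from the most significant one. *)
Definition mul_com (a b z : nat) : com :=
  Seq (reverse_onto a z.+1)
    (Seq (While z.+1 (pop_if z.+1 (fun x => Seq (double_com z)
        (if x is Some true then Seq (copy_com b z.+2 z.+3) (add_com z z.+2 z.+3) else Skip))))
      (Seq (While b (Pop b)) (Seq (reverse_onto z z.+1) (reverse_onto z.+1 a)))).

Lemma size_bits_mul x y : size (bits (x * y)) <= size (bits x) + size (bits y).
Proof.
apply: size_bits_le; rewrite expnD; case: (posnP x) => [->|x0].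
  by rewrite muln_gt0 !expn_gt0.
by apply: ltn_mul; apply: lt_size_bits.
Qed.

Lemma size_bits_mono x y : x <= y -> size (bits x) <= size (bits y).
Proof. by move=> le_xy; apply: size_bits_le; apply: leq_ltn_trans (lt_size_bits y). Qed.

Lemma within_mul a b z s x y : a != b -> a < z -> b < z ->
    s a = bits x -> s b = bits y -> (forall i, z <= i -> s i = [::]) ->
  within (mul_com a b z) s ((size (bits x) + size (bits y)).+1 ^ 2 * 80)
    (upd (upd s a (bits (x * y))) b [::]).
Proof.
move=> ab az bz sa sb sz.
set n := size (bits x) + size (bits y).
pose w := rev (bits x).
(* After k rounds z holds the product of y with the k leading digits of x. *)
pose acc k := value (rev (take k w)) * y.
pose inv k := upd (upd (upd s a [::]) z (bits (acc k))) z.+1 (drop k w).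
have acc_le k : acc k <= x * y.
  rewrite /acc leq_mul2r; apply/orP; right; rewrite -(value_bits x).
  rewrite -[X in _ <= value X]revK -/w -{2}(cat_take_drop k w) rev_cat.
  elim: (rev (drop k w)) => //= c v; case: c; lia.
have sacc k : size (bits (acc k)) <= n.
  by apply: leq_trans (size_bits_mono (acc_le k)) _; apply: size_bits_mul.
have R1 : within (reverse_onto a z.+1) s (size (bits x) * 5).+1 (inv 0).
  have -> : inv 0 = upd (upd s a [::]) z.+1 (catrev (s a) (s z.+1)).
    by rewrite /inv /acc take0 drop0 /= bits0 sa (sz z.+1) // -/(rev _) -/w; stores; rewrite sz.
  by rewrite -sa; apply: within_reverse_onto; lia.
have R2 : within (While z.+1 (pop_if z.+1 (fun x => Seq (double_com z)
        (if x is Some true then Seq (copy_com b z.+2 z.+3) (add_com z z.+2 z.+3) else Skip))))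
    (inv 0) (size w * (n * 47 + 40).+1).+1 (inv (size w)).
  apply: within_while => k ltk; first by rewrite /inv; regs.
  have -> : n * 47 + 40 = (3 + (n * 47 + 35)).+2 by lia.
  apply: within_pop_if.
  have -> : inv k z.+1 = drop k w by rewrite /inv; regs.
  rewrite (drop_nth false) //=; set s1 := upd _ _ _.
  have s1z : s1 z = bits (acc k) by rewrite /s1 /inv; regs.
  apply: within_seq (within_double s1z) _.
  set s2 := upd s1 _ _.
  have s2b : s2 b = bits y by rewrite /s2 /s1 /inv; regs.
  have s2z i : z.+2 <= i -> s2 i = [::].
    by move=> lei; rewrite /s2 /s1 /inv; regs; apply: sz; lia.
  have s2c : s2 z.+1 = drop k.+1 w by rewrite /s2 /s1; regs.
  have s2a : s2 z = bits (acc k).*2 by rewrite /s2; regs.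
  have Ek : acc k.+1 = (acc k).*2 + nth false w k * y.
    by rewrite /acc (take_nth false) // rev_rcons /=; lia.
  have E : inv k.+1 = upd s2 z (bits (acc k.+1)).
    by rewrite /s2 /s1 /inv; stores.
  case: (nth false w k) Ek => Ek; last first.
    have -> : inv k.+1 = s2 by rewrite E Ek mul0n addn0 -s2a; stores.
    by apply: within_le (within_skip _) _; lia.
  pose s3 := upd s2 z.+2 (bits y).
  have C : within (copy_com b z.+2 z.+3) s2 (size (bits y) * 13).+2 s3.
    by rewrite /s3 -s2b; apply: within_copy; try lia; apply: s2z; lia.
  have A : within (add_com z z.+2 z.+3) s3
      ((size (bits (acc k).*2) + size (bits y)) * 17 + 13) (inv k.+1).
    have -> : inv k.+1 = upd (upd s3 z (bits ((acc k).*2 + y))) z.+2 [::].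
      by rewrite E Ek mul1n /s3; stores; apply: s2z.
    by apply: within_add; try lia; rewrite /s3; regs; apply: s2z; lia.
  apply: within_le (within_seq C A) _.
  have : size (bits (acc k).*2) <= n.
    by apply: leq_trans (sacc k.+1); apply: size_bits_mono; rewrite Ek leq_addr.
  by rewrite /n; lia.
have Ew : acc (size w) = x * y by rewrite /acc take_size revK value_bits.
set s1 := inv (size w) in R2.
have R3 := within_clear b s1.
set s2 := upd s1 b [::] in R3.
have s1b : s1 b = bits y by rewrite /s1 /inv; regs.
have R4 := @within_reverse_onto z z.+1 s2.
have R5 := @within_reverse_onto z.+1 a.
have s2z : s2 z = bits (x * y) by rewrite /s2 /s1 /inv -Ew; regs.
have s2z1 : s2 z.+1 = [::] by rewrite /s2 /s1 /inv; regs; rewrite drop_size.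
rewrite s2z s2z1 -/(rev _) in R4.
set s3 := upd _ _ _ in R4.
have s3z : s3 z.+1 = rev (bits (x * y)) by rewrite /s3; regs.
have s3a : s3 a = [::] by rewrite /s3 /s2 /s1 /inv; regs.
have E : upd (upd s3 z.+1 [::]) a (catrev (s3 z.+1) (s3 a)) =
    upd (upd s a (bits (x * y))) b [::].
  rewrite s3z s3a -/(rev _) revK /s3 /s2 /s1 /inv; stores; rewrite sz //; lia.
rewrite -E; apply: within_le (within_seq R1 (within_seq R2 (within_seq R3
  (within_seq (R4 _) (R5 s3 _))))) _; try lia.
rewrite s1b s3z size_rev; have := size_bits_mul x y.
have : size w <= n by rewrite /w size_rev /n; lia.
rewrite -/n expnS expn1; have : size (bits x) <= n by rewrite /n; lia.
have : size (bits y) <= n by rewrite /n; lia.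
set p := size (bits (x * y)); move: (size w) (size (bits x)) (size (bits y)) p.
clear; move: n => n a b c d; nia.
Qed.

(** * Arithmetic functions of two words *)

Definition poly_bounded (g : nat -> nat) : Prop :=
  exists p : {poly nat}, forall n, g n <= p.[n]%R.

Lemma poly_bounded_const c : poly_bounded (fun=> c).
Proof. by exists (c%:P)%R => n; rewrite hornerC. Qed.

Lemma poly_bounded_id : poly_bounded id.
Proof. by exists 'X%R => n; rewrite hornerX. Qed.

Lemma poly_bounded_add g h :
  poly_bounded g -> poly_bounded h -> poly_bounded (fun n => g n + h n).
Proof. by move=> [p Hp] [q Hq]; exists (p + q)%R => n; rewrite hornerD; apply: leq_add. Qed.

Lemma poly_bounded_mul g h :
  poly_bounded g -> poly_bounded h -> poly_bounded (fun n => g n * h n).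
Proof. by move=> [p Hp] [q Hq]; exists (p * q)%R => n; rewrite hornerM; apply: leq_mul. Qed.

Lemma poly_bounded_S g : poly_bounded g -> poly_bounded (fun n => (g n).+1).
Proof.
move=> Hg; have := poly_bounded_add Hg (poly_bounded_const 1).
by move=> [p Hp]; exists p => n; rewrite -addn1.
Qed.

Lemma poly_bounded_exp g k : poly_bounded g -> poly_bounded (fun n => g n ^ k).
Proof.
move=> Hg; elim: k => [|k [p Hp]]; first exact: poly_bounded_const.
by case: Hg => q Hq; exists (q * p)%R => n; rewrite hornerM expnS; apply: leq_mul.
Qed.

Ltac poly_bound := repeat first [ assumption | apply: poly_bounded_id
  | apply: poly_bounded_const | apply: poly_bounded_S | apply: poly_bounded_exp
  | apply: poly_bounded_add | apply: poly_bounded_mul ].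

Record env := Env { input : seq bool; cert : seq bool; vars : seq nat }.

Definition push (v : nat) (e : env) : env := Env (input e) (cert e) (v :: vars e).
Definition pop (e : env) : env := Env (input e) (cert e) (behead (vars e)).
Definition top (e : env) : nat := head 0 (vars e).
Definition word (b : bool) (e : env) : seq bool := if b then cert e else input e.

(** Loops run over the positions of one of the words, and bind the position and
    the digit found there.  Iteration is confined to sums and products, whose
    values have polynomially many digits if their terms have. *)
Inductive arith : (env -> nat) -> Prop :=
  | ArithOne : arith (fun=> 1)
  | ArithTop : arith top
  | ArithPop F : arith F -> arith (fun e => F (pop e))
  | ArithAdd F G : arith F -> arith G -> arith (fun e => F e + G e)
  | ArithSub F G : arith F -> arith G -> arith (fun e => F e - G e)
  | ArithMul F G : arith F -> arith G -> arith (fun e => F e * G e)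
  | ArithSum b F : arith F -> arith (fun e =>
      \sum_(i < size (word b e)) F (push i (push (nth false (word b e) i) e)))
  | ArithProd b F : arith F -> arith (fun e =>
      \prod_(i < size (word b e)) F (push i (push (nth false (word b e) i) e))).

Definition env_size (e : env) : nat := size (input e) + size (cert e).

(** The variables of e are found in the registers vm, and the registers from d
    on are free. *)
Definition env_in_store (e : env) (vm : seq nat) (d : nat) (s : store) : Prop :=
  [/\ (s 0 = input e /\ s 1 = cert e), 2 <= d,
      [seq s r | r <- vm] = [seq bits v | v <- vars e] /\ all (ltn^~ d) vm,
      all (leq^~ (env_size e)) (vars e) & forall i, d <= i -> s i = [::]].

Definition value_bounded (F : env -> nat) (L : nat -> nat) : Prop :=
  forall e, all (leq^~ (env_size e)) (vars e) -> F e < 2 ^ L (env_size e).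

Definition computes (P : seq nat -> nat -> com) (F : env -> nat)
    (T : nat -> nat) : Prop :=
  forall e vm d s, env_in_store e vm d s ->
    within (P vm d) s (T (env_size e)) (upd s d (bits (F e))).

Definition poly_computable (F : env -> nat) : Prop :=
  exists P L T, [/\ poly_bounded L, poly_bounded T,
    value_bounded F L & computes P F T].

Lemma env_in_store_upd e vm d s w : env_in_store e vm d s ->
  env_in_store e vm d.+1 (upd s d w).
Proof.
move=> [[s0 s1] d2 [Evm lt_vm] le_v free]; split=> //.
- by rewrite /upd !ifN //; lia.
- by lia.
- split; last by apply: sub_all lt_vm => i /=; apply: leqW.
  rewrite -Evm; apply/eq_in_map => r /(allP lt_vm) /= ltr; regs.
- by move=> i lti; regs; apply: free; lia.
Qed.

Section Operation.

Variables (op : nat -> nat -> nat) (opc : nat -> nat -> nat -> com) (t : nat -> nat).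

(** The common shape of [within_add], [within_sub] and [within_mul]. *)
Definition operation : Prop := (forall m n, m <= n -> t m <= t n) /\
  forall a b z s x y, a != b -> a < z -> b < z ->
    s a = bits x -> s b = bits y -> (forall i, z <= i -> s i = [::]) ->
    within (opc a b z) s (t (size (bits x) + size (bits y)))
      (upd (upd s a (bits (op x y))) b [::]).

(** A subprogram leaves its value in the first free register and uses only later
    ones, so the values of F and G end up in consecutive registers. *)
Lemma poly_computable_op F G : operation ->
    (forall g, poly_bounded g -> poly_bounded (fun n => t (g n))) ->
    (forall M x y, x < 2 ^ M -> y < 2 ^ M -> op x y < 2 ^ M.*2.+1) ->
  poly_computable F -> poly_computable G ->
  poly_computable (fun e => op (F e) (G e)).
Proof.
move=> [t_mono Hop] Ht Hb [P [L [T [HL HT BF HP]]]] [Q [L' [T' [HL' HT' BG HQ]]]].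
exists (fun vm d => Seq (P vm d) (Seq (Q vm d.+1) (opc d d.+1 d.+2))).
exists (fun n => (L n + L' n).*2.+1), (fun n => T n + (T' n + t (L n + L' n))).
split=> [||e le_v|e vm d s Hs].
- have : poly_bounded (fun n => ((L n + L' n) * 2).+1) by poly_bound.
  by case=> p Hp; exists p => n; rewrite -muln2.
- by apply: poly_bounded_add => //; apply: poly_bounded_add => //; apply: Ht; poly_bound.
- by apply: Hb; [apply: leq_trans (BF _ le_v) _|apply: leq_trans (BG _ le_v) _];
    rewrite leq_exp2l //; lia.
have R1 := HP _ _ _ _ Hs.
have R2 := HQ _ _ _ _ (env_in_store_upd (bits (F e)) Hs).
set s2 := upd (upd _ _ _) _ _ in R2.
have [_ _ _ le_v free] := Hs.
have R3 : within (opc d d.+1 d.+2) s2 (t (size (bits (F e)) + size (bits (G e))))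
    (upd (upd s2 d (bits (op (F e) (G e)))) d.+1 [::]).
  by apply: Hop => [||||| i lti]; try lia; rewrite /s2; regs; apply: free; lia.
have E : upd (upd s2 d (bits (op (F e) (G e)))) d.+1 [::] =
    upd s d (bits (op (F e) (G e))).
  by rewrite /s2; stores; rewrite free.
rewrite -E; apply: within_le (within_seq R1 (within_seq R2 R3)) _.
rewrite !leq_add2l; apply: t_mono.
by apply: leq_add; apply: size_bits_le; [apply: BF|apply: BG].
Qed.

(** The loop: d accumulates the result, d.+1 holds what remains of the word,
    d.+2 and d.+3 hold the position and the digit bound by the loop. *)
Definition fold_com (b : bool) (init : nat -> com) (P : seq nat -> nat -> com)
    (vm : seq nat) (d : nat) : com :=
  Seq (init d) (Seq (copy_com b d.+1 d.+2) (Seq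
    (While d.+1 (pop_if d.+1 (fun x =>
      Seq (if x == Some true then Push d.+3 true else Skip)
     (Seq (P (d.+2 :: d.+3 :: vm) d.+4)
     (Seq (opc d d.+4 d.+4.+1)
     (Seq (While d.+3 (Pop d.+3))
     (Seq (Push d.+4 true) (add_com d.+2 d.+4 d.+4.+1))))))))
    (While d.+2 (Pop d.+2)))).

Lemma within_fold_com b idx init F P L T (LA : nat -> nat) e vm d s :
    operation -> value_bounded F L -> computes P F T -> env_in_store e vm d s ->
    (forall d s, s d = [::] -> within (init d) s 2 (upd s d (bits idx))) ->
    let N := env_size e in let w := word b e in
    let G i := F (push i (push (nth false w i) e)) in
    (forall k, k <= size w -> \big[op/idx]_(i < k) G i < 2 ^ LA N) ->
    (forall k, \big[op/idx]_(i < k.+1) G i = op (\big[op/idx]_(i < k) G i) (G k)) ->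
  within (fold_com b init P vm d) s
    (N * (T N + t (LA N + L N) + N * 17 + 60) + N * 20 + 20)
    (upd s d (bits (\big[op/idx]_(i < size w) G i))).
Proof.
move=> [t_mono Hop] BF HP Hs Hinit N w G HLA bigS.
have [[s0 s1] d2 [Evm lt_vm] le_v free] := Hs.
pose acc k := \big[op/idx]_(i < k) G i.
pose inv k := upd (upd (upd s d (bits (acc k))) d.+1 (drop k w)) d.+2 (bits k).
have le_w : size w <= N by rewrite /w /N /env_size; case: (b) => /=; lia.
have sb r : r < d -> s r = upd s d (bits idx) r by move=> ltr; regs.
have swb : s b = w by rewrite /w; case: (b).
have R0 := Hinit d s (free d (leqnn d)).
have R1 : within (copy_com b d.+1 d.+2) (upd s d (bits idx)) (size w * 13).+2 (inv 0).
  have -> : inv 0 = upd (upd s d (bits idx)) d.+1 (upd s d (bits idx) b).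
    rewrite /inv /acc big_ord0 drop0 bits0 -sb ?swb; last by case: (b); lia.
    by stores; rewrite free //; lia.
  rewrite -swb (sb b); last by case: (b); lia.
  by apply: within_copy; try (case: (b); lia); regs; apply: free; lia.
have R2 : within (While d.+1 (pop_if d.+1 (fun x =>
      Seq (if x == Some true then Push d.+3 true else Skip)
     (Seq (P (d.+2 :: d.+3 :: vm) d.+4)
     (Seq (opc d d.+4 d.+4.+1)
     (Seq (While d.+3 (Pop d.+3))
     (Seq (Push d.+4 true) (add_com d.+2 d.+4 d.+4.+1))))))))
    (inv 0) (size w * (T N + t (LA N + L N) + N * 17 + 59).+1).+1 (inv (size w)).
  apply: within_while => k ltk; first by rewrite /inv; regs.
  (* The summands are the running times of the instructions of one round. *)
  have Et : T N + t (LA N + L N) + N * 17 + 59 =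
    (2 + (T N + (t (LA N + L N) + (3 + (2 + (N * 17 + 50)))))).+2 by lia.
  rewrite Et; apply: within_pop_if.
  have -> : inv k d.+1 = drop k w by rewrite /inv; regs.
  rewrite (drop_nth false) //=; set x := nth false w k; set st := upd _ _ _.
  pose st1 := upd st d.+3 (bits x).
  have S1 : within (if Some x == Some true then Push d.+3 true else Skip) st 2 st1.
    have st3 : st d.+3 = [::] by rewrite /st /inv; regs; apply: free; lia.
    rewrite /st1; case: (x) => /=.
      by have := within_push st d.+3 true; rewrite st3 bits1.
    rewrite bits0 (_ : upd st d.+3 [::] = st); last by stores.
    exact: within_le (within_skip _) _.
  pose e1 := push k (push x e).
  have Nw : size w > 0 by apply: leq_ltn_trans ltk.
  have He : env_in_store e1 (d.+2 :: d.+3 :: vm) d.+4 st1.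
    split=> //.
    - by rewrite /st1 /st /inv; split; regs.
    - split; last first.
        rewrite /= ltnS leqnn leqW //=; apply: sub_all lt_vm => i /=; lia.
      rewrite /= -Evm; congr [:: _, _ & _].
      + by rewrite /st1 /st /inv; regs.
      + by rewrite /st1 /st /inv; regs.
      + by apply/eq_in_map => r /(allP lt_vm) /= ltr; rewrite /st1 /st /inv; regs.
    - rewrite /= -/(env_size e) -/N; apply/and3P; split=> //.
      + by apply: leq_trans le_w; apply: ltnW.
      + by case: (x) => //; apply: leq_trans le_w.
    - by move=> i lti; rewrite /st1 /st /inv; regs; apply: free; lia.
  have S2 := HP _ _ _ _ He; have bF := BF e1 (let: And5 _ _ _ le_v1 _ := He in le_v1).
  have Ne : env_size e1 = N by [].
  rewrite Ne in S2 bF; set st2 := upd st1 _ _ in S2.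
  have Ek : acc k.+1 = op (acc k) (F e1) by rewrite /acc bigS.
  have S3 : within (opc d d.+4 d.+4.+1) st2 (t (LA N + L N))
      (upd (upd st2 d (bits (acc k.+1))) d.+4 [::]).
    apply: within_le (t_mono _ _ _); last first.
      apply: leq_add; last exact: size_bits_le bF.
      by apply: size_bits_le (HLA k _); apply: ltnW.
    rewrite Ek; apply: Hop => [||||| i lti]; try lia; rewrite /st2 /st1 /st /inv; regs.
    by apply: free; lia.
  set st3 := upd (upd _ _ _) _ _ in S3.
  have S4 : within (While d.+3 (Pop d.+3)) st3 3 (upd st3 d.+3 [::]).
    apply: within_le (within_clear _ _) _.
    have -> : st3 d.+3 = bits x by rewrite /st3 /st2 /st1; regs.
    by have := @size_bits_le x 1; case: (x) => /(_ isT); lia.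
  set st4 := upd st3 _ _ in S4.
  have S5 := within_push st4 d.+4 true.
  have st4d : st4 d.+4 = [::] by rewrite /st4 /st3; regs.
  rewrite st4d in S5; set st5 := upd st4 _ _ in S5.
  have S6 : within (add_com d.+2 d.+4 d.+4.+1) st5 (N * 17 + 50) (inv k.+1).
    have -> : inv k.+1 = upd (upd st5 d.+2 (bits (k + 1))) d.+4 [::].
      rewrite addn1 /st5 /st4 /st3 /st2 /st1 /st /inv; stores; rewrite ?free //; lia.
    have sk : size (bits k) <= N.
      by apply: size_bits_le; apply: ltn_trans (ltn_expl _ _) => //; lia.
    have s1' : size (bits 1) = 1 by rewrite bits1.
    apply: within_le (within_add (x := k) (y := 1) _ _ _ _ _ _ _) _; try lia;
      rewrite /st5 /st4 /st3 /st2 /st1 /st /inv; regs.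
    - by apply: free; lia.
    - by apply: free; lia.
  exact: within_seq S1 (within_seq S2 (within_seq S3 (within_seq S4 (within_seq S5 S6)))).
have R3 := within_clear d.+2 (inv (size w)).
have E : upd (inv (size w)) d.+2 [::] = upd s d (bits (acc (size w))).
  by rewrite /inv drop_size; stores; rewrite free //; lia.
rewrite E in R3; apply: within_le (within_seq R0 (within_seq R1 (within_seq R2 R3))) _.
have -> : inv (size w) d.+2 = bits (size w) by rewrite /inv; regs.
have : size (bits (size w)) <= N.
  apply: leq_trans le_w; apply: size_bits_le; exact: ltn_expl.
move: (T N + t (LA N + L N) + N * 17) => q.
by move: (size (bits _)) => r; move: le_w; move: (size w) => m; clear; nia.
Qed.

End Operation.

Lemma operation_add : operation addn add_com (fun n => n * 17 + 13).
Proof.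
split=> [m n|a b z s x y ab az bz sa sb free]; first by lia.
by apply: within_add => //; apply: free; lia.
Qed.

Lemma operation_sub : operation subn sub_com (fun n => n * 19 + 13).
Proof.
split=> [m n|a b z s x y ab az bz sa sb free]; first by lia.
by apply: within_sub => //; apply: free; lia.
Qed.

Lemma operation_mul : operation muln mul_com (fun n => n.+1 ^ 2 * 80).
Proof.
split=> [m n|a b z s x y]; last exact: within_mul.
by move=> le_mn; rewrite leq_mul2r leq_exp2r.
Qed.

Lemma poly_computable_fold op opc t b idx init F (A : nat -> nat -> nat) :
    operation op opc t ->
    (forall g, poly_bounded g -> poly_bounded (fun n => t (g n))) ->
    (forall d s, s d = [::] -> within (init d) s 2 (upd s d (bits idx))) ->
    (forall (G : nat -> nat) k,
       \big[op/idx]_(i < k.+1) G i = op (\big[op/idx]_(i < k) G i) (G k)) ->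
    (forall (G : nat -> nat) L N k, (forall i, i < k -> G i < 2 ^ L) -> k <= N ->
       \big[op/idx]_(i < k) G i < 2 ^ A L N) ->
    (forall L, poly_bounded L -> poly_bounded (fun n => A (L n) n)) ->
  poly_computable F -> poly_computable (fun e => \big[op/idx]_(i < size (word b e))
    F (push i (push (nth false (word b e) i) e))).
Proof.
move=> Hop Ht Hi bigS Hb HA [P [L [T [HL HT BF HP]]]].
have HLA := HA _ HL.
have B e k : all (leq^~ (env_size e)) (vars e) -> k <= size (word b e) ->
    \big[op/idx]_(i < k) F (push i (push (nth false (word b e) i) e)) <
    2 ^ A (L (env_size e)) (env_size e).
  move=> le_v le_k; have le_w : size (word b e) <= env_size e.
    by rewrite /env_size; case: (b) => /=; lia.
  apply: (Hb (fun i => F (push i (push (nth false (word b e) i) e)))); last by lia.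
  move=> i lti.
  have Ee : env_size (push i (push (nth false (word b e) i) e)) = env_size e by [].
  rewrite -Ee; apply: BF; rewrite Ee /= le_v andbT; apply/andP; split; first by lia.
  by case: nth; lia.
exists (fold_com opc b init P), (fun n => A (L n) n).
exists (fun n => n * (T n + t (A (L n) n + L n) + n * 17 + 60) + n * 20 + 20).
split=> // [|e le_v|e vm d s Hs].
- have := Ht _ (poly_bounded_add HLA HL) => Htt.
  by poly_bound.
- exact: B.
apply: (within_fold_com (LA := fun n => A (L n) n) Hop BF HP Hs) => // k.
  by apply: B; case: Hs.
exact: (bigS (fun i => F (push i (push (nth false (word b e) i) e)))).
Qed.

(** Values have polynomially many digits and loops have linearly many rounds, so
    each construct preserves polynomial time. *)
Theorem arith_poly_computable F : arith F -> poly_computable F.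
Proof.
elim=> {F} [||F _ IH|F G _ IHF _ IHG|F G _ IHF _ IHG|F G _ IHF _ IHG|b F _ IH|b F _ IH].
- exists (fun _ d => Push d true), (fun=> 1), (fun=> 2).
  split=> // [||e vm d s [_ _ _ _ free]]; try exact: poly_bounded_const.
  by have := within_push s d true; rewrite free.
- exists (fun vm d => if vm is r :: _ then copy_com r d d.+1 else Skip).
  exists id, (fun n => n * 13 + 2).
  split=> [||e le_v|e vm d s [_ _ [Evm lt_vm] le_v free]]; try by poly_bound.
    rewrite /top; case: (vars e) le_v => [|v vs] /=; first by rewrite expn_gt0.
    by case/andP=> lev _; apply: leq_ltn_trans lev (ltn_expl _ _).
  rewrite /top; case: vm (vars e) Evm le_v lt_vm => [|r vm] [|v vs] //=.
    move=> _ _ _; rewrite bits0 (_ : upd s d [::] = s); last by stores; rewrite free.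
    by apply: within_le (within_skip _) _; lia.
  case=> Er _ /andP[lev _] /andP[ltr _]; rewrite -Er.
  apply: within_le (within_copy _ _ _ _ _) _; try lia; try (apply: free; lia).
  rewrite Er; have : size (bits v) <= env_size e.
    by apply: size_bits_le; apply: leq_ltn_trans lev (ltn_expl _ _).
  lia.
- case: IH => [P [L [T [HL HT BF HP]]]].
  exists (fun vm => P (behead vm)), L, T; split=> // [e le_v|e vm d s].
    apply: (BF (pop e)); move: le_v; rewrite -[env_size (pop e)]/(env_size e) /=.
    by case: (vars e) => //= v vs /andP[].
  move=> [s01 d2 [Evm lt_vm] le_v free].
  apply: (HP (pop e)); split=> //.
    split; first by rewrite /= -!behead_map Evm.
    by case: (vm) lt_vm => //= r ? /andP[].
  by rewrite -[env_size _]/(env_size e) /=; case: (vars e) le_v => //= v vs /andP[].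
- apply: (poly_computable_op operation_add) => // [g Hg|M x y ltx lty]; first by poly_bound.
  by rewrite expnS -addnn expnD; have := expn_gt0 2 M; nia.
- apply: (poly_computable_op operation_sub) => // [g Hg|M x y ltx lty]; first by poly_bound.
  apply: leq_ltn_trans (leq_subr _ _) _; apply: leq_trans ltx _.
  by rewrite leq_exp2l //; lia.
- apply: (poly_computable_op operation_mul) => // [g Hg|M x y ltx lty]; first by poly_bound.
  by rewrite expnS -addnn expnD; nia.
- apply: (poly_computable_fold b (init := fun _ => Skip)
    (A := fun L N => L + N) operation_add) => //.
  + by move=> g Hg; poly_bound.
  + move=> d s sd; rewrite bits0 (_ : upd s d [::] = s); last by stores; rewrite sd.
    by apply: within_le (within_skip _) _.
  + by move=> G k; rewrite big_ord_recr.
  + move=> G L N k HG le_k; apply: (@leq_ltn_trans (\sum_(i < k) 2 ^ L)).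
      by apply: leq_sum => i _; apply: ltnW; apply: HG.
    rewrite sum_nat_const card_ord expnD mulnC ltn_pmul2l ?expn_gt0 //.
    exact: leq_ltn_trans le_k (ltn_expl _ _).
  + by move=> L HL; poly_bound.
- apply: (poly_computable_fold b (init := fun d => Push d true)
    (A := fun L N => (L * N).+1) operation_mul) => //.
  + by move=> g Hg; poly_bound.
  + move=> d s sd; have := within_push s d true; rewrite sd.
    by rewrite bits1.
  + by move=> G k; rewrite big_ord_recr.
  + move=> G L N k HG le_k; apply: (@leq_ltn_trans (\prod_(i < k) 2 ^ L)).
      by apply: leq_prod => i _; apply: ltnW; apply: HG.
    rewrite prod_nat_const card_ord -expnM ltn_exp2l // ltnS leq_mul2l le_k.
    exact: orbT.
  + by move=> L HL; poly_bound.
Qed.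

Theorem poly_time_arith (R : seq bool -> seq bool -> bool) F : arith F ->
  (forall x u, F (Env x u [::]) = R x u) -> poly_time R.
Proof.
move=> /arith_poly_computable[P [L [T [_ [p Hp] _ HP]]]] FR.
apply: (@poly_time_program R (P [::] 2) 2 p) => x u.
have Hs : env_in_store (Env x u [::]) [::] 2 (initial_store x u).
  by split=> // [[|[|i]]].
have [t le_t E] := HP _ _ _ _ Hs.
exists t, (upd (initial_store x u) 2 (bits (F (Env x u [::])))); split=> //.
  exact: leq_trans le_t (Hp _).
rewrite upd_same FR; case: (R x u); last by rewrite bits0.
by rewrite bits1.
Qed.

(** * Closure properties of arithmetic functions *)

Lemma arith_ext F G : F =1 G -> arith F -> arith G.
Proof. by move/functional_extensionality=> ->. Qed.

(** Weakening by the two variables that a loop binds. *)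
Lemma arith_lift F : arith F -> arith (fun e => F (pop (pop e))).
Proof. by move=> HF; apply: (ArithPop (F := fun e => F (pop e))); apply: ArithPop. Qed.

Ltac lifts := match goal with
  | H : arith _ |- arith _ => solve [exact: H | exact: (arith_lift H)
    | exact: (arith_lift (arith_lift H)) | exact: (arith_lift (arith_lift (arith_lift H)))]
  end.

Lemma arith0 : arith (fun=> 0).
Proof. by apply: arith_ext (ArithSub ArithOne ArithOne). Qed.

Lemma arith_const c : arith (fun=> c).
Proof.
elim: c => [|c IH]; first exact: arith0.
by apply: arith_ext (ArithAdd IH ArithOne) => e; rewrite addn1.
Qed.

Lemma arith_min F G : arith F -> arith G -> arith (fun e => minn (F e) (G e)).
Proof.
move=> HF HG; apply: arith_ext (ArithSub HF (ArithSub HF HG)) => e; lia.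
Qed.

Definition arithb (b : env -> bool) : Prop := arith (fun e => b e).

Lemma arithb_ext b c : b =1 c -> arithb b -> arithb c.
Proof. by move=> E; apply: arith_ext => e; rewrite E. Qed.

Lemma arithb_and b c : arithb b -> arithb c -> arithb (fun e => b e && c e).
Proof. by move=> Hb Hc; apply: arith_ext (ArithMul Hb Hc) => e; rewrite mulnb. Qed.

Lemma arithb_leq F G : arith F -> arith G -> arithb (fun e => F e <= G e).
Proof.
move=> HF HG; apply: arith_ext (ArithSub ArithOne (ArithSub HF HG)) => e.
by case: leqP; lia.
Qed.

Lemma arithb_ltn F G : arith F -> arith G -> arithb (fun e => F e < G e).
Proof. by move=> HF HG; apply: arithb_leq HG; apply: arith_ext (ArithAdd ArithOne HF). Qed.

Lemma arithb_eq F G : arith F -> arith G -> arithb (fun e => F e == G e).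
Proof.
move=> HF HG; apply: arithb_ext (arithb_and (arithb_leq HF HG) (arithb_leq HG HF)) => e.
by rewrite eqn_leq.
Qed.

Lemma pop_push v e : pop (push v e) = e. Proof. by case: e. Qed.

Section Loops.

Variables (b : bool) (K : env -> nat).
Hypothesis HK : arith K.
Hypothesis K_le : forall e, K e <= size (word b e).

(** A bound below the length of the word is imposed by dropping the later
    terms. *)
Lemma arith_fold_sum (F : env -> nat) : arith F -> arith (fun e =>
  \sum_(i < K e) F (push i (push (nth false (word b e) i) e))).
Proof.
move=> HF; pose G e := (top e < K (pop (pop e))) * F e.
have HG : arith G by apply: ArithMul HF; apply: arithb_ltn; [apply: ArithTop|lifts].
apply: arith_ext (ArithSum b HG) => e.
pose Fe i := F (push i (push (nth false (word b e) i) e)).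
rewrite (big_ord_widen _ Fe (K_le e)) [RHS]big_mkcond {}/Fe.
by apply: eq_bigr => i _; rewrite /G !pop_push; case: ifP; rewrite ?mul1n // => ->.
Qed.

Lemma arith_fold_prod (F : env -> nat) : arith F -> arith (fun e =>
  \prod_(i < K e) F (push i (push (nth false (word b e) i) e))).
Proof.
move=> HF; pose G e := let c : nat := top e < K (pop (pop e)) in c * F e + (1 - c).
have Hc : arith (fun e => top e < K (pop (pop e))).
  by apply: arithb_ltn; [apply: ArithTop|lifts].
have HG : arith G by apply: ArithAdd; [apply: ArithMul|apply: ArithSub; [apply: ArithOne|]].
apply: arith_ext (ArithProd b HG) => e.
pose Fe i := F (push i (push (nth false (word b e) i) e)).
rewrite (big_ord_widen _ Fe (K_le e)) [RHS]big_mkcond {}/Fe.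
apply: eq_bigr => i _; rewrite /G !pop_push -[top _]/(nat_of_ord i).
by case: ifP => _ /=; lia.
Qed.

Lemma arith_sum (G : env -> nat -> nat) :
  arith (fun e => G (pop (pop e)) (top e)) -> arith (fun e => \sum_(i < K e) G e i).
Proof.
move/arith_fold_sum; apply: arith_ext => e.
by apply: eq_bigr => i _; rewrite !pop_push.
Qed.

Lemma arith_prod (G : env -> nat -> nat) :
  arith (fun e => G (pop (pop e)) (top e)) -> arith (fun e => \prod_(i < K e) G e i).
Proof.
move/arith_fold_prod; apply: arith_ext => e.
by apply: eq_bigr => i _; rewrite !pop_push.
Qed.

End Loops.

Lemma arith_size b : arith (fun e => size (word b e)).
Proof.
apply: arith_ext (ArithSum b ArithOne) => e.
by rewrite sum_nat_const card_ord muln1.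
Qed.

(** Random access: a sum over all positions in which only one term survives. *)
Lemma arith_nth b I : arith I -> arithb (fun e => nth false (word b e) (I e)).
Proof.
move=> HI; pose F e := (top e == I (pop (pop e))) * top (pop e).
have HF : arith F.
  apply: ArithMul; first by apply: arithb_eq; [apply: ArithTop|lifts].
  exact: ArithPop ArithTop.
apply: arith_ext (ArithSum b HF) => e.
have E (i : 'I_(size (word b e))) : F (push i (push (nth false (word b e) i) e)) =
    if (i : nat) == I e then nth false (word b e) (I e) : nat else 0.
  by rewrite /F !pop_push -[top _]/(nat_of_ord i); case: eqP => [->|]; rewrite ?mul1n.
rewrite (eq_bigr _ (fun i _ => E i)) -big_mkcond.
case: (ltnP (I e) (size (word b e))) => [lt_I|le_I].
  by rewrite (big_pred1 (Ordinal lt_I)).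
rewrite nth_default //; apply: big1 => i /eqP Ei.
by move: (ltn_ord i); rewrite Ei ltnNge le_I.
Qed.

(** The exponent is the number of factors 2, so it cannot exceed the length of a
    word. *)
Lemma arith_pow2 b I : arith I ->
  arith (fun e => 2 ^ minn (I e) (size (word b e))).
Proof.
move=> HI; pose J e := minn (I e) (size (word b e)).
have HJ : arith J by apply: arith_min HI (arith_size b).
apply: arith_ext (arith_prod (b := b) (K := J) HJ _ (G := fun _ _ => 2) _) => [e|e|].
- by rewrite prod_nat_const card_ord.
- exact: geq_minr.
- exact: arith_const.
Qed.

Lemma arith_horner (p : {poly nat}) I : arith I -> arith (fun e => p.[I e]%R).
Proof.
move=> HI; elim/poly_ind: p => [|p c IH].
  by apply: arith_ext arith0 => e; rewrite horner0.
apply: arith_ext (ArithAdd (ArithMul IH HI) (arith_const c)) => e.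
by rewrite hornerMXaddC.
Qed.

Lemma value_sum w N : size w <= N -> value w = \sum_(i < N) nth false w i * 2 ^ i.
Proof.
elim: N w => [|N IH] [|b w] //=; first by rewrite big_ord0.
  by move=> _; rewrite big1 // => i _; rewrite nth_nil.
rewrite ltnS => /IH ->; rewrite big_ord_recl /= muln1 -muln2 big_distrl /=.
by congr (_ + _); apply: eq_bigr => i _; rewrite -mulnA -expnSr.
Qed.

(** Beyond the end of the certificate all digits are 0, so the sum may run over
    all its positions. *)
Lemma arith_window O W : arith O -> arith W ->
  arith (fun e => value (take (W e) (drop (O e) (cert e)))).
Proof.
move=> HO HW.
pose G e i := (i < W e) * (nth false (cert e) (O e + i) * 2 ^ minn i (size (cert e))).
have HG : arith (fun e => G (pop (pop e)) (top e)).
  apply: ArithMul; first by apply: arithb_ltn; [apply: ArithTop|lifts].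
  apply: ArithMul; last exact: (arith_pow2 true ArithTop).
  by apply: (arith_nth true); apply: ArithAdd; [lifts|apply: ArithTop].
apply: arith_ext (arith_sum (b := true) (arith_size true) _ HG) => // e /=.
rewrite (@value_sum _ (size (cert e))); last first.
  by rewrite size_take_min size_drop; lia.
apply: eq_bigr => i _; rewrite /G (minn_idPl (ltnW (ltn_ord i))).
case: (ltnP i (W e)) => ltiW; first by rewrite mul1n nth_take // nth_drop.
rewrite mul0n nth_default ?mul0n // (leq_trans _ ltiW) //.
by rewrite size_take; case: ltnP.
Qed.

(** Changes of variables, the old variables being arithmetic functions of the
    new ones. *)
Definition substitution (g : env -> env) : Prop :=
  [/\ forall e, input (g e) = input e, forall e, cert (g e) = cert e
    & forall i, arith (fun e => nth 0 (vars (g e)) i)].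

Lemma arith_var i : arith (fun e => nth 0 (vars e) i).
Proof.
elim: i => [|i IH]; first by apply: arith_ext ArithTop => e; rewrite nth0.
by apply: arith_ext (ArithPop IH) => e /=; rewrite nth_behead.
Qed.

Lemma substitution_id : substitution id.
Proof. by split=> // i; apply: arith_var. Qed.

Lemma substitution_push I g : arith I -> substitution g ->
  substitution (fun e => push (I e) (g e)).
Proof. by move=> HI [gi gc gv]; split=> [e|e|[|i]] /=; do ?[exact: gi|exact: gc]. Qed.

Lemma substitution_pop g : substitution g -> substitution (fun e => pop (g e)).
Proof.
move=> [gi gc gv]; split=> // i.
by apply: arith_ext (gv i.+1) => e /=; rewrite nth_behead.
Qed.

Lemma substitution_comp g h : substitution g ->
    (forall F, arith F -> arith (fun e => F (h e))) ->
    (forall e, input (h e) = input e) -> (forall e, cert (h e) = cert e) ->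
  substitution (fun e => g (h e)).
Proof.
move=> [gi gc gv] Hh hi hc; split=> [e|e|i]; rewrite ?gi ?gc //.
exact: (Hh _ (gv i)).
Qed.

Lemma arith_subst F g : arith F -> substitution g -> arith (fun e => F (g e)).
Proof.
move=> HF; elim: HF g => {F} [||F _ IH|F G _ IHF _ IHG|F G _ IHF _ IHG|F G _ IHF _ IHG
    |b F _ IH|b F _ IH] g Hg.
- exact: ArithOne.
- by case: Hg => _ _ /(_ 0); apply: arith_ext => e; rewrite nth0.
- exact: (IH _ (substitution_pop Hg)).
- exact: (ArithAdd (IHF _ Hg) (IHG _ Hg)).
- exact: (ArithSub (IHF _ Hg) (IHG _ Hg)).
- exact: (ArithMul (IHF _ Hg) (IHG _ Hg)).
all: pose h e := push (top e) (push (top (pop e)) (g (pop (pop e)))).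
all: have Hh : substitution h by
  (apply: (substitution_push ArithTop); apply: (substitution_push (ArithPop ArithTop));
   apply: substitution_comp => //; apply: arith_lift).
all: have gw e : word b (g e) = word b e by case: Hg => gi gc _; case: (b); rewrite /= ?gi ?gc.
- apply: arith_ext (ArithSum b (IH _ Hh)) => e; rewrite gw; apply: eq_bigr => i _.
  by rewrite /h !pop_push.
- apply: arith_ext (ArithProd b (IH _ Hh)) => e; rewrite gw; apply: eq_bigr => i _.
  by rewrite /h !pop_push.
Qed.

(** ** Words given by their length and their digits *)

(** In the second condition the position of the digit is an additional
    variable. *)
Definition ariths (S : env -> seq bool) : Prop :=
  arith (fun e => size (S e)) /\ arithb (fun e => nth false (S (pop e)) (top e)).

Lemma ariths_nth S g I : ariths S -> substitution g -> arith I ->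
  arithb (fun e => nth false (S (g e)) (I e)).
Proof.
move=> [_ Hn] Hg HI; apply: arith_ext (arith_subst Hn (substitution_push HI Hg)) => e.
by rewrite pop_push.
Qed.

Lemma ariths_ext S T : S =1 T -> ariths S -> ariths T.
Proof. by move/functional_extensionality=> ->. Qed.

Lemma ariths_word b : ariths (word b).
Proof.
split; [exact: arith_size|apply: arithb_ext (arith_nth b ArithTop) => e].
by case: (b).
Qed.

Lemma ariths_digit c : arithb c -> ariths (fun e => [:: c e]).
Proof.
move=> Hc; split; first exact: ArithOne.
apply: arithb_ext (arithb_and (arithb_eq ArithTop arith0) (ArithPop Hc)) => e.
by case: (top e) => [|[|i]].
Qed.

Lemma ariths_cat S T : ariths S -> ariths T -> ariths (fun e => S e ++ T e).
Proof.
move=> HS HT; have [HsS HnS] := HS; have [HsT _] := HT; split.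
  by apply: arith_ext (ArithAdd HsS HsT) => e; rewrite size_cat.
have Hs := ArithPop HsS; have Hg := substitution_pop substitution_id.
apply: arith_ext (ArithAdd HnS (ArithMul (arithb_leq Hs ArithTop)
  (ariths_nth HT Hg (ArithSub ArithTop Hs)))) => e; rewrite nth_cat.
by case: ltnP => [_|le_I]; rewrite ?mul0n ?addn0 ?mul1n // nth_default.
Qed.

Lemma size_flatten_iota (G : nat -> seq bool) m :
  size (flatten [seq G i | i <- iota 0 m]) = \sum_(i < m) size (G i).
Proof.
elim: m => [|k IHk]; first by rewrite big_ord0.
by rewrite -addn1 iotaD map_cat flatten_cat size_cat IHk addn1 big_ord_recr /= cats0.
Qed.

Lemma nth_flatten_iota (G : nat -> seq bool) m j :
  nth false (flatten [seq G i | i <- iota 0 m]) j =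
  \sum_(i < m) (\sum_(h < i) size (G h) <= j) *
    nth false (G i) (j - \sum_(h < i) size (G h)) :> nat.
Proof.
elim: m j => [|m IH] j; first by rewrite big_ord0 nth_nil.
rewrite -addn1 iotaD map_cat flatten_cat nth_cat size_flatten_iota addn1 big_ord_recr /= cats0.
case: ltnP => [lt_j|le_j]; first by rewrite IH mul0n addn0.
by rewrite mul1n -IH (nth_default _ (s := flatten _)) ?size_flatten_iota.
Qed.

(** A block starts at the sum of the lengths of the blocks before it.  A position
    past the end of a block reads 0 there, so the sum over all blocks that start
    before the position yields the digit. *)
Lemma ariths_flatten b K (G : env -> nat -> seq bool) :
    arith K -> (forall e, K e <= size (word b e)) ->
    ariths (fun e => G (pop (pop e)) (top e)) ->
  ariths (fun e => flatten [seq G e i | i <- iota 0 (K e)]).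
Proof.
move=> HK K_le HG; have [Hs Hn] := HG; split.
  apply: arith_ext (arith_sum HK K_le (G := fun e i => size (G e i)) Hs) => e.
  by rewrite size_flatten_iota.
have K_le' e : K (pop e) <= size (word b e).
  by apply: leq_trans (K_le _) _; case: (b).
pose off e m := \sum_(h < minn m (size (word b e))) size (G e h).
have at3 J F : arith J -> arith (fun e => F (pop (pop e)) (top e)) ->
    arith (fun e => F (pop (pop (pop e))) (J e)).
  move=> HJ HF; pose g e := push (J e) (push 0 (pop (pop (pop e)))).
  have Hg : substitution g.
    apply: substitution_push => //; apply: substitution_push arith0 _.
    by do 3![apply: substitution_pop]; apply: substitution_id.
  by apply: arith_ext (arith_subst HF Hg) => e; rewrite /g !pop_push.
have Hoff : arith (fun e => off (pop (pop e)) (top e)).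
  apply: (@arith_sum b _ _ _ (fun e h => size (G (pop (pop e)) h))).
  - by apply: arith_ext (arith_min ArithTop (arith_size b)) => e; case: (b).
  - by move=> e; apply: leq_trans (geq_minr _ _) _; case: (b).
  pose g e := push (top e) (push 0 (pop (pop (pop (pop e))))).
  have Hg : substitution g.
    apply: substitution_push ArithTop _; apply: substitution_push arith0 _.
    by do 4![apply: substitution_pop]; apply: substitution_id.
  by apply: arith_ext (arith_subst Hs Hg) => e; rewrite /g !pop_push.
have Hoff3 := at3 _ off ArithTop Hoff.
have Hj : arith (fun e => top (pop (pop e))) by apply: arith_lift ArithTop.
pose g e := push (top e) (push 0 (pop (pop (pop e)))).
have Hg : substitution g.
  apply: substitution_push ArithTop _; apply: substitution_push arith0 _.
  by do 3![apply: substitution_pop]; apply: substitution_id.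
apply: arith_ext (arith_sum (b := b) (K := fun e => K (pop e)) (ArithPop HK) K_le'
  (G := fun e i => (off (pop e) i <= top e) *
    nth false (G (pop e) i) (top e - off (pop e) i)) _) => [e|].
  rewrite nth_flatten_iota; apply: eq_bigr => i _; rewrite /off.
  suff -> : minn i (size (word b (pop e))) = i by [].
  by apply/minn_idPl; apply: leq_trans (K_le (pop e)); apply: ltnW.
apply: ArithMul; first exact: arithb_leq.
apply: arith_ext (ariths_nth HG Hg (ArithSub Hj Hoff3)) => e.
by rewrite /g !pop_push.
Qed.

Lemma arithb_all b K (B : env -> nat -> bool) :
    arith K -> (forall e, K e <= size (word b e)) ->
    arithb (fun e => B (pop (pop e)) (top e)) ->
  arithb (fun e => all (fun i => B e i) (iota 0 (K e))).
Proof.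
move=> HK K_le HB; apply: arith_ext (arith_prod HK K_le (G := fun e i => B e i) HB) => e.
elim: (K e) => [|m IH]; first by rewrite big_ord0.
by rewrite -addn1 iotaD all_cat addn1 big_ord_recr /= IH andbT mulnb.
Qed.

Lemma arithb_eqs b S T : (forall e, size (S e) <= size (word b e)) ->
  ariths S -> ariths T -> arithb (fun e => S e == T e).
Proof.
move=> S_le HS HT; have [HsS _] := HS; have [HsT _] := HT.
have Hg := substitution_pop (substitution_pop substitution_id).
have Hall : arithb (fun e => all (fun i => (nth false (S e) i : nat) == nth false (T e) i)
    (iota 0 (size (S e)))).
  by apply: (arithb_all HsS S_le); apply: arithb_eq; apply: ariths_nth => //; apply: ArithTop.
apply: arithb_ext (arithb_and (arithb_eq HsS HsT) Hall) => e.
apply/andP/eqP => [[/eqP Es /allP En]|->]; last by split=> //; apply/allP.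
apply: (eq_from_nth (x0 := false) Es) => i lti.
by have /(_ i) := En; rewrite mem_iota lti => /(_ isT); do 2!case: nth.
Qed.

(** ** Integer-valued functions, as differences *)

Definition arithz (Z : env -> int) : Prop :=
  exists P N, [/\ arith P, arith N & forall e, Z e = ((P e)%:Z - (N e)%:Z)%R].

Lemma arithz_ext Y Z : Y =1 Z -> arithz Y -> arithz Z.
Proof. by move/functional_extensionality=> ->. Qed.

Lemma arithz_nat F : arith F -> arithz (fun e => (F e)%:Z)%R.
Proof. by move=> HF; exists F, (fun=> 0); split=> // [|e]; [apply: arith0|rewrite subr0]. Qed.

Lemma arithz_opp Z : arithz Z -> arithz (fun e => - Z e)%R.
Proof. by move=> [P [N [HP HN E]]]; exists N, P; split=> // e; rewrite E opprB. Qed.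

Lemma arithz_const c : arithz (fun=> c).
Proof.
case: c => m; first by apply: arithz_nat; apply: arith_const.
by rewrite NegzE; apply: arithz_opp; apply: arithz_nat; apply: arith_const.
Qed.

Lemma arithz_add Y Z : arithz Y -> arithz Z -> arithz (fun e => Y e + Z e)%R.
Proof.
move=> [P [N [HP HN E]]] [P' [N' [HP' HN' E']]].
exists (fun e => P e + P' e), (fun e => N e + N' e).
by split=> [||e]; [exact: ArithAdd|exact: ArithAdd|rewrite E E'; lia].
Qed.

Lemma arithz_mul Y Z : arithz Y -> arithz Z -> arithz (fun e => Y e * Z e)%R.
Proof.
move=> [P [N [HP HN E]]] [P' [N' [HP' HN' E']]].
exists (fun e => P e * P' e + N e * N' e), (fun e => P e * N' e + N e * P' e).
by split=> [||e]; do ?[apply: ArithAdd|apply: ArithMul] => //; rewrite E E'; lia.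
Qed.

Lemma arithz_sum b K (Z : env -> nat -> int) :
    arith K -> (forall e, K e <= size (word b e)) ->
    arithz (fun e => Z (pop (pop e)) (top e)) ->
  arithz (fun e => \sum_(0 <= i < K e) Z e i)%R.
Proof.
move=> HK K_le [P [N [HP HN E]]].
have HP' := arith_fold_sum HK K_le HP; have HN' := arith_fold_sum HK K_le HN.
exists (fun e => \sum_(i < K e) P (push i (push (nth false (word b e) i) e))).
exists (fun e => \sum_(i < K e) N (push i (push (nth false (word b e) i) e))).
split=> // e.
rewrite big_mkord !(big_morph Posz PoszD (erefl _)) -sumrB; apply: eq_bigr => i _.
by rewrite -E !pop_push.
Qed.

Lemma arithz_fsum (I : Type) (r : seq I) (Z : env -> I -> int) :
  (forall i, arithz (fun e => Z e i)) -> arithz (fun e => \sum_(i <- r) Z e i)%R.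
Proof.
move=> HZ; elim: r => [|i r IH].
  by apply: arithz_ext (arithz_const 0%R) => e; rewrite big_nil.
by apply: arithz_ext (arithz_add (HZ i) IH) => e; rewrite big_cons.
Qed.

Lemma arithb_eqz Y Z : arithz Y -> arithz Z -> arithb (fun e => Y e == Z e).
Proof.
move=> [P [N [HP HN E]]] [P' [N' [HP' HN' E']]].
apply: arithb_ext (arithb_eq (ArithAdd HP HN') (ArithAdd HP' HN)) => e.
by rewrite E E'; apply/eqP/eqP; lia.
Qed.

Local Open Scope ring_scope.

(** * Sizes of matrices and of solutions of linear systems *)

Definition mx_size_le (R : numDomainType) p q (M : 'M[R]_(p, q)) (h : nat) : Prop :=
  forall i j, `|M i j| <= 2 ^+ h.

Section Size.

Variable R : numDomainType.

Lemma exp2_le m n : (m <= n)%N -> 2 ^+ m <= 2 ^+ n :> R.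
Proof. by move=> le_mn; rewrite ler_eXn2l // ltr1n. Qed.

Lemma natr_le_exp2 n : n%:R <= 2 ^+ n :> R.
Proof. by rewrite -natrX ler_nat ltnW // ltn_expl. Qed.

Lemma mx_size_leW p q (M : 'M[R]_(p, q)) h k :
  mx_size_le M h -> (h <= k)%N -> mx_size_le M k.
Proof. by move=> HM le_hk i j; apply: le_trans (HM i j) (exp2_le le_hk). Qed.

Lemma norm_sum_le (I : finType) (F : I -> R) m h :
    (#|I| <= m)%N -> (forall i, `|F i| <= 2 ^+ h) ->
  `|\sum_i F i| <= 2 ^+ (m + h).
Proof.
move=> le_m HF; apply: le_trans (ler_norm_sum _ _ _) _.
apply: le_trans (ler_sum _ (fun i _ => HF i)) _.
rewrite sumr_const exprD -[X in X <= _]mulr_natl ler_pM ?ler0n ?exprn_ge0 //.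
by apply: le_trans (natr_le_exp2 _) (exp2_le le_m).
Qed.

Lemma mx_size_le_mul p q r (M : 'M[R]_(p, q)) (N : 'M_(q, r)) m h k :
    (q <= m)%N -> mx_size_le M h -> mx_size_le N k ->
  mx_size_le (M *m N) (m + (h + k)).
Proof.
move=> le_m HM HN i j; rewrite mxE; apply: norm_sum_le; first by rewrite card_ord.
by move=> l; rewrite normrM exprD ler_pM.
Qed.

Lemma mx_size_le_mxvec p q (A : 'M[R]_(p, q)) h :
  mx_size_le A h -> mx_size_le (mxvec A) h.
Proof.
by move=> HA i j; case/mxvec_indexP: j => j l; rewrite (ord1 i) mxvecE.
Qed.

Lemma norm_det_le p (M : 'M[R]_p) h : mx_size_le M h ->
  `|\det M| <= 2 ^+ (p * p + p * h).
Proof.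
move=> HM; apply: le_trans (ler_norm_sum _ _ _) _.
have E (s : 'S_p) : true -> `|(-1) ^+ s * \prod_i M i (s i)| <= 2 ^+ (p * h).
  move=> _; rewrite normrM normrX normrN1 expr1n mul1r normr_prod mulnC exprM.
  rewrite -[p in leRHS]card_ord -prodr_const.
  by apply: ler_prod => i _; rewrite normr_ge0 HM.
apply: le_trans (ler_sum _ E) _.
rewrite sumr_const exprD -[X in X <= _]mulr_natl ler_pM ?ler0n ?exprn_ge0 //.
rewrite -natrX ler_nat card_Sn.
have : (p`! <= p ^ p)%N.
  rewrite fact_prod -[X in (_ ^ X)%N]card_ord -prod_nat_const.
  by rewrite big_add1 /= big_mkord; apply: leq_prod.
move=> H; apply: leq_trans H _; rewrite expnM.
by case: (p) => // p'; rewrite leq_exp2r // ltnW // ltn_expl.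
Qed.

End Size.

(** By Cramer's rule on a maximal minor: its determinant is a nonzero integer,
    so that dividing by it does not increase absolute values. *)
Lemma bounded_solution p q (C : 'M[int]_(p, q)) (b : 'rV[rat]_q) h k :
    mx_size_le C h -> mx_size_le b k ->
    (exists x : 'rV[rat]_p, x *m map_mx intr C = b) ->
  exists2 y : 'rV[rat]_p, y *m map_mx intr C = b &
    mx_size_le y (p + (p + k + (p * p + p * h))).
Proof.
move=> HC Hb [x Ex]; set Cr := map_mx intr C in Ex *.
pose f := maxrankfun Cr; pose D0 := rowsub f Cr.
have full : row_full D0^T by rewrite /row_full mxrank_tr; exact: maxrowsub_free.
pose g := fullrankfun full.
pose Z := mxsub f g C.
have ED : rowsub g D0^T = (map_mx intr Z)^T by apply/matrixP => i j; rewrite !mxE.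
have /(_ full) := @fullrowsub_unit _ _ _ D0^T; rewrite -/g ED unitmx_tr => uZ.
have [y0 Ey0] : exists y0, b = y0 *m D0.
  by apply/submxP; rewrite eq_maxrowsub -Ex submxMl.
have Ebg : colsub g b = y0 *m map_mx intr Z.
  by rewrite Ey0; apply/matrixP => i j; rewrite !mxE; apply: eq_bigr => l _; rewrite !mxE.
have y0E : y0 = colsub g b *m invmx (map_mx intr Z) by rewrite Ebg mulmxK.
exists (y0 *m rowsub f 1%:M).
  by rewrite -mulmxA mul_rowsub_mx mul1mx -Ey0.
have le_r : (\rank Cr <= p)%N by apply: rank_leq_row.
have detZ : 1 <= `|\det (map_mx intr Z : 'M[rat]_(\rank Cr))|.
  have := uZ; rewrite unitmxE unitfE det_map_mx intr_eq0 => nz.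
  by rewrite -intr_norm -[1]/(1%:~R) ler_int -gtz0_ge1 normr_gt0.
have Hadj : mx_size_le (\adj (map_mx intr Z : 'M[rat]_(\rank Cr))) (p * p + p * h).
  move=> i j; rewrite mxE /cofactor normrM normrX normrN1 expr1n mul1r.
  set M' := row' _ _.
  have HM : mx_size_le M' h.
    by move=> i' j'; rewrite !mxE -intr_norm -[2](intrD _ 1 1) -rmorphXn ler_int HC.
  apply: le_trans (norm_det_le HM) _; apply: exp2_le.
  by apply: leq_add; [apply: leq_mul|apply: leq_mul]; lia.
have Hinv : mx_size_le (invmx (map_mx intr Z : 'M[rat]_(\rank Cr))) (p * p + p * h).
  move=> i j; rewrite /invmx uZ mxE normrM normfV.
  apply: le_trans (Hadj i j); by apply: ler_piMl; rewrite ?invf_le1 ?(lt_le_trans ltr01).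
have Hy0 : mx_size_le y0 (p + (k + (p * p + p * h))).
  rewrite y0E; apply: mx_size_le_mul Hinv => // i j; rewrite mxE; exact: Hb.
apply: mx_size_leW (mx_size_le_mul (k := 0) le_r Hy0 _) _; last by lia.
by move=> i j; rewrite !mxE; case: eqP; rewrite ?normr0 ?normr1.
Qed.

(** * Newton iteration *)

Lemma rat_size (c : rat) : exists k, `|c| <= 2 ^+ k.
Proof.
exists (Num.Def.archi_bound `|c|); apply: le_trans (natr_le_exp2 _ _).
by apply: ltW; apply: archi_boundP.
Qed.

Lemma mx_size_le_horner (p : {poly rat}) : exists k d : nat,
  forall n (M : 'M[rat]_n.+1) m h, (n < m)%N -> mx_size_le M h ->
    mx_size_le (horner_mx M p) (k + d * (m + h)).
Proof.
elim/poly_ind: p => [|p c [k [d IH]]].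
  by exists 0%N, 0%N => n M m h _ _ i j; rewrite rmorph0 mxE normr0.
have [l Hl] := rat_size c; exists (k + l).+1, d.+1 => n M m h lt_m HM i j.
rewrite rmorphD rmorphM /= horner_mx_X horner_mx_C mxE.
apply: le_trans (ler_normD _ _) _; rewrite addSn exprS mulr2n mulrDl mul1r.
apply: lerD.
  have := mx_size_le_mul lt_m (IH _ _ _ _ lt_m HM) HM i j => H.
  by apply: le_trans H (exp2_le _ _); lia.
rewrite mxE; apply: (@le_trans _ _ (2 ^+ l)); last by apply: exp2_le; lia.
by case: eqP; rewrite ?mulr0n ?normr0 ?exprn_ge0 // mulr1n.
Qed.

Lemma taylor2 n (a h : 'M[rat]_n.+1) (P : {poly rat}) : GRing.comm a h ->
  exists s, [/\ horner_mx (a + h) P =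
      horner_mx a P + horner_mx a P^`() * h + s * h ^+ 2,
    GRing.comm a s & GRing.comm h s].
Proof.
move=> cah; elim/poly_ind: P => [|p c [s [Es cas chs]]].
  exists 0; split; [|exact: commr0|exact: commr0].
  by rewrite deriv0 !rmorph0 !mul0r !addr0.
have cap q : GRing.comm a (horner_mx a q) by apply: comm_mx_horner.
have chp q : GRing.comm h (horner_mx a q).
  by apply: comm_mx_horner; apply: commr_sym.
exists (horner_mx a p^`() + s * a + s * h); split.
- rewrite derivMXaddC !rmorphD !rmorphM /= !horner_mx_X !horner_mx_C Es.
  have -> : (horner_mx a p + horner_mx a p^`() * h + s * h ^+ 2) * (a + h) =
    horner_mx a p * a + horner_mx a p * h + (horner_mx a p^`() * a * h +
     horner_mx a p^`() * h ^+ 2) + (s * a * h ^+ 2 + s * h * h ^+ 2).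
    have hha : h * (h * a) = a * (h * h) by rewrite -cah !mulrA -cah.
    by rewrite !expr2 !mulrDl !mulrDr -!mulrA hha -cah.
  by rewrite !mulrDl [LHS](AC (2*2*2*1) ((1*7)*(2*3)*(4*5*6))).
- by apply: commrD; [apply: commrD|]; do ?[exact: cap|apply: commrM].
- by apply: commrD; [apply: commrD|]; do ?[exact: chp|apply: commrM]; apply: commr_sym.
Qed.

(** A polynomial with a critical fixed point a doubles the order of contact of
    a nilpotent perturbation of a. *)
Lemma newton_step n (a h : 'M[rat]_n.+1) (P : {poly rat}) m :
    horner_mx a P = a -> horner_mx a P^`() = 0 -> GRing.comm a h ->
    h ^+ m.*2 = 0 ->
  exists h', [/\ horner_mx (a + h) P = a + h', GRing.comm a h' & h' ^+ m = 0].
Proof.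
move=> Pa P'a cah hm0; have [s [-> cas chs]] := taylor2 P cah.
exists (s * h ^+ 2); split; first by rewrite Pa P'a mul0r addr0.
  by apply: commrM => //; apply: commrX.
rewrite exprMn_comm; last by apply: commrX; apply: commr_sym.
by rewrite -exprM mul2n hm0 mulr0.
Qed.

Lemma newton_iter n (a h : 'M[rat]_n.+1) (P : {poly rat}) k :
    horner_mx a P = a -> horner_mx a P^`() = 0 -> GRing.comm a h ->
    h ^+ (2 ^ k) = 0 ->
  iter k (fun M => horner_mx M P) (a + h) = a.
Proof.
move=> Pa P'a; elim: k h => [|k IH] h cah.
  by rewrite expn0 expr1 => ->; rewrite addr0.
rewrite expnS mul2n => /(newton_step Pa P'a cah)[h' [E cah' h'0]].
by rewrite iterSr E IH.
Qed.

Lemma mx_size_le_iter (P : {poly rat}) : exists k d : nat,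
  forall n (M : 'M[rat]_n.+1) m h t, (n < m)%N -> mx_size_le M h ->
    mx_size_le (iter t (fun M => horner_mx M P) M) (d ^ t * (h + m + k)).
Proof.
have [k [d HP]] := mx_size_le_horner P; exists k, d.+2 => n M m h t lt_m HM.
suff: mx_size_le (iter t (fun M => horner_mx M P) M) (d.+2 ^ t * (h + m + k) - (m + k)).
  by move/mx_size_leW; apply; apply: leq_subr.
elim: t => [|t IH] /=.
  by rewrite expn0 mul1n -addnA addnK.
apply: mx_size_leW (HP _ _ _ _ lt_m IH) _.
rewrite expnS; have : (0 < d.+2 ^ t)%N by rewrite expn_gt0.
move: (d.+2 ^ t)%N => e; clear -m; nia.
Qed.

Section Separable.

Variable f : {poly int}.
Hypothesis sep_f : separable_int_poly f.

Lemma separable_neq0 : f != 0.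
Proof.
apply: contra_notN (sep_f (z := 0)) => /eqP->.
by rewrite /double_root map_poly0 dvdp0.
Qed.

(** A common root of f and f' would be a double root. *)
Lemma separable_coprime :
  coprimep (map_poly intr f : {poly rat}) (map_poly intr f)^`().
Proof.
have ratr_intr (p : {poly int}) :
    map_poly ratr (map_poly intr p : {poly rat}) = map_poly intr p :> {poly algC}.
  by rewrite -map_poly_comp; apply: eq_map_poly => x; apply: ratr_int.
rewrite -(coprimep_map (@ratr algC)) deriv_map !ratr_intr -deriv_map.
apply: Pdiv.ClosedField.root_coprimep => z fz; apply/negP => /eqP f'z.
apply: (@sep_f z); rewrite /double_root.
move: fz f'z; rewrite -dvdp_XsubCl => /dvdpP[q ->].
rewrite derivM derivXsubC mulr1 hornerD hornerM hornerXsubC subrr mulr0 add0r => qz.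
by rewrite expr2 dvdp_mul2r ?polyXsubC_eq0 // dvdp_XsubCl; apply/eqP.
Qed.

(** Newton's method X - f / f', with the inverse of f' modulo f for 1 / f'. *)
Lemma newton_polynomial : exists P : {poly rat},
  forall n (a : 'M[rat]_n.+1), horner_mx a (map_poly intr f) = 0 ->
    horner_mx a P = a /\ horner_mx a P^`() = 0.
Proof.
have /Bezout_eq1_coprimepP[[u v] /= Euv] := separable_coprime.
set g := map_poly intr f in Euv *.
exists ('X - v * g) => n a ga; split.
  by rewrite rmorphB rmorphM /= ga mulr0 subr0 horner_mx_X.
have -> : ('X - v * g)^`() = (u - v^`()) * g.
  by rewrite derivB derivX derivM -Euv mulrBl opprD addrACA subrr addr0.
by rewrite rmorphM /= ga mulr0.
Qed.

Lemma root_size : exists r, forall z : algC, root (map_poly intr f) z -> `|z| <= 2 ^+ r.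
Proof.
have [rs Ers] := closed_field_poly_normal (map_poly intr f : {poly algC}).
exists (Num.Def.archi_bound (\sum_(z <- rs) `|z|)) => z.
have lc0 : lead_coef (map_poly intr f : {poly algC}) != 0.
  rewrite lead_coef_eq0 map_poly_eq0_id0 ?separable_neq0 //.
  by rewrite intr_eq0 lead_coef_eq0 separable_neq0.
rewrite Ers rootZ // root_prod_XsubC => zrs.
apply: le_trans (natr_le_exp2 _ _).
apply: le_trans (ltW (archi_boundP _)); last by apply: sumr_ge0.
by rewrite (big_rem z) //= lerDl sumr_ge0.
Qed.

End Separable.

(** * Characters of a commuting family of matrices *)

(** The diagonal entries in a common triangular form are the characters of the
    algebra that the matrices span. *)
Section Characters.

Variables (n : nat) (P : 'M[algC]_n.+1).
Hypothesis uP : P \in unitmx.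

Definition conj_by (A : 'M[algC]_n.+1) : 'M[algC]_n.+1 := P *m A *m invmx P.
Definition trig (A : 'M[algC]_n.+1) : Prop := is_trig_mx (conj_by A).
Definition chi (i : 'I_n.+1) (A : 'M[algC]_n.+1) : algC := conj_by A i i.

Lemma conj_byM A B : conj_by (A *m B) = conj_by A *m conj_by B.
Proof. by rewrite /conj_by !mulmxA mulmxKV. Qed.

Lemma conj_byD A B : conj_by (A + B) = conj_by A + conj_by B.
Proof. by rewrite /conj_by mulmxDr mulmxDl. Qed.

Lemma conj_byZ c A : conj_by (c *: A) = c *: conj_by A.
Proof. by rewrite /conj_by -scalemxAr -scalemxAl. Qed.

Lemma conj_by_scalar c : conj_by c%:M = c%:M.
Proof. by rewrite /conj_by scalar_mxC -mulmxA mulmxV // mulmx1. Qed.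

Lemma tr_chi A : \tr A = \sum_i chi i A.
Proof. by rewrite -[RHS]/(\tr (conj_by A)) /conj_by mxtrace_mulC mulKmx. Qed.

Lemma trigD A B : trig A -> trig B -> trig (A + B).
Proof.
move=> /is_trig_mxP tA /is_trig_mxP tB; apply/is_trig_mxP => i j ltij.
by rewrite conj_byD mxE tA // tB // addr0.
Qed.

Lemma trigZ c A : trig A -> trig (c *: A).
Proof.
move=> /is_trig_mxP tA; apply/is_trig_mxP => i j ltij.
by rewrite conj_byZ mxE tA // mulr0.
Qed.

Lemma trig_scalar c : trig c%:M.
Proof.
apply/is_trig_mxP => i j ltij; rewrite conj_by_scalar mxE.
by case: eqP ltij => [->|]; rewrite ?ltnn.
Qed.

Lemma trigM A B : trig A -> trig B -> trig (A *m B).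
Proof.
move=> /is_trig_mxP tA /is_trig_mxP tB; apply/is_trig_mxP => i j ltij.
rewrite conj_byM mxE big1 // => k _.
case: (ltnP i k) => [ltik|leki]; first by rewrite tA // mul0r.
by rewrite tB ?mulr0 // (leq_ltn_trans leki).
Qed.

Lemma chiD i A B : chi i (A + B) = chi i A + chi i B.
Proof. by rewrite /chi conj_byD mxE. Qed.

Lemma chi_scalar i c : chi i c%:M = c.
Proof. by rewrite /chi conj_by_scalar mxE eqxx. Qed.

Lemma chiM i A B : trig A -> trig B -> chi i (A *m B) = chi i A * chi i B.
Proof.
move=> /is_trig_mxP tA /is_trig_mxP tB; rewrite /chi conj_byM mxE.
rewrite (bigD1 i) //= big1 ?addr0 // => k; rewrite neq_lt => /orP[ltki|ltik].
  by rewrite tB // mulr0.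
by rewrite tA // mul0r.
Qed.

Lemma trig_horner A p : trig A ->
  trig (horner_mx A p) /\ forall i, chi i (horner_mx A p) = p.[chi i A].
Proof.
move=> tA; elim/poly_ind: p => [|p c [tp chip]].
  rewrite rmorph0 -(raddf0 (@scalar_mx algC n.+1)); split; first exact: trig_scalar.
  by move=> i; rewrite chi_scalar horner0.
rewrite rmorphD rmorphM /= horner_mx_X horner_mx_C; split.
  by apply: trigD (trig_scalar c); apply: trigM.
by move=> i; rewrite chiD chi_scalar chiM // chip hornerMXaddC.
Qed.

Lemma trig_sum (I : finType) (F : I -> 'M[algC]_n.+1) : (forall i, trig (F i)) ->
  trig (\sum_i F i).
Proof.
move=> tF; apply: (big_ind trig) => //; last exact: trigD.
by rewrite -(raddf0 (@scalar_mx algC n.+1)); apply: trig_scalar.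
Qed.

Lemma chi_eigenvalue i A : trig A -> eigenvalue A (chi i A).
Proof.
move=> tA; have : eigenvalue (conj_by A) (chi i A).
  rewrite eigenvalue_root_char char_poly_trig // rootE horner_prod.
  by apply/prodf_eq0; exists i; rewrite // hornerXsubC subrr.
case/eigenvalueP => v Ev nzv; apply/eigenvalueP; exists (v *m P).
  by rewrite scalemxAl -Ev /conj_by !mulmxA mulmxKV.
by apply: contraNneq nzv => vP0; rewrite -(mulmxK uP v) vP0 mul0mx.
Qed.

(** The sum of the norms of the coordinates of an eigenvector is compared with
    that of its image. *)
Lemma chi_size i A m h : (n < m)%N -> trig A -> mx_size_le A h ->
  `|chi i A| <= 2 ^+ (m + h).
Proof.
move=> lt_m /(@chi_eigenvalue i) /eigenvalueP[v Ev nzv] HA.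
set lam := chi i A in Ev *; pose s := \sum_j `|v 0 j|.
have s_gt0 : 0 < s.
  rewrite lt_def sumr_ge0 // andbT; apply: contraNneq nzv => s0.
  apply/eqP/rowP => j; rewrite mxE; apply/normr0_eq0.
  by move/eqP: s0; rewrite psumr_eq0 // => /allP/(_ j (mem_index_enum j))/eqP.
rewrite -(ler_pM2r s_gt0) mulr_sumr.
have Ek k : `|lam| * `|v 0 k| = `|\sum_j v 0 j * A j k|.
  by rewrite -normrM; congr `|_|; move/rowP/(_ k): Ev; rewrite !mxE.
rewrite (eq_bigr _ (fun k _ => Ek k)).
have le_k k : `|\sum_j v 0 j * A j k| <= s * 2 ^+ h.
  apply: le_trans (ler_norm_sum _ _ _) _; rewrite mulr_suml.
  by apply: ler_sum => j _; rewrite normrM ler_wpM2l.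
apply: le_trans (ler_sum _ (fun k _ => le_k k)) _.
rewrite sumr_const card_ord -[leLHS]mulr_natl exprD -mulrA [s * _]mulrC ler_wpM2r //.
  by rewrite mulr_ge0 ?exprn_ge0 // ltW.
by apply: le_trans (natr_le_exp2 _ _) (exp2_le _ _).
Qed.

Lemma chi_pow i A k : trig A -> trig (A ^+ k) /\ chi i (A ^+ k) = chi i A ^+ k.
Proof.
move=> tA; elim: k => [|k [tk Ek]]; last first.
  by rewrite !exprS; split; [apply: trigM|rewrite chiM // Ek].
by rewrite !expr0; split; [apply: trig_scalar|rewrite chi_scalar].
Qed.

Lemma conj_by_pow A k : conj_by (A ^+ k) = conj_by A ^+ k.
Proof.
by elim: k => [|k IH]; rewrite ?expr0 ?conj_by_scalar // !exprS [LHS]conj_byM IH.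
Qed.

Lemma chi_eq0_nilpotent A : trig A -> (forall i, chi i A = 0) -> A ^+ n.+1 = 0.
Proof.
move=> tA chi0; have := Cayley_Hamilton (conj_by A).
rewrite char_poly_trig //.
rewrite (eq_bigr (fun=> 'X)) => [|i _]; last by rewrite -/(chi i A) chi0 subr0.
rewrite prodr_const card_ord rmorphXn /= horner_mx_X -conj_by_pow /conj_by => E.
have : invmx P *m (P *m A ^+ n.+1 *m invmx P) *m P = 0.
  by rewrite E mulmx0 mul0mx.
by rewrite !mulmxA mulVmx // mul1mx mulmxKV.
Qed.

(** Vanishing power sums force the values to vanish: a nonzero value would be
    singled out by a polynomial divisible by X^2 that vanishes at the others. *)
Lemma power_sums_eq0 (x : 'I_n.+1 -> algC) :
  (forall k, (1 < k)%N -> \sum_i x i ^+ k = 0) -> forall i, x i = 0.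
Proof.
move=> x0 i; apply/eqP; apply/negPn/negP => nzi.
pose rs := [seq r <- undup [seq x j | j <- enum 'I_n.+1] | r != x i].
pose q : {poly algC} := \prod_(r <- rs) ('X - r%:P).
have sum0 (p : {poly algC}) k : (1 < k)%N -> \sum_j x j ^+ k * p.[x j] = 0.
  elim/poly_ind: p k => [|p c IH] k lt1k.
    by rewrite big1 // => j _; rewrite horner0 mulr0.
  rewrite (eq_bigr (fun j => x j ^+ k.+1 * p.[x j] + x j ^+ k * c)) => [|j _].
    by rewrite big_split /= IH 1?ltnW // add0r -mulr_suml x0 ?mul0r.
  by rewrite hornerMXaddC mulrDr exprSr -mulrA [x j * _]mulrC.
have := sum0 q _ (ltnSn 1).
have Eq j : x j ^+ 2 * q.[x j] = if x j == x i then x i ^+ 2 * q.[x i] else 0.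
  case: eqP => [-> //|/eqP nij]; suff -> : q.[x j] = 0 by rewrite mulr0.
  apply/eqP; rewrite -rootE root_prod_XsubC mem_filter nij mem_undup.
  by apply: map_f; rewrite mem_enum.
rewrite (eq_bigr _ (fun j _ => Eq j)) -big_mkcond sumr_const => /eqP.
rewrite mulrn_eq0 mulf_eq0 expf_eq0 (negPf nzi) andbF -rootE root_prod_XsubC.
rewrite mem_filter eqxx /= !orbF => /eqP card0.
by have := card0_eq card0 i; rewrite unfold_in [LHS](eqxx (x i)).
Qed.

End Characters.

(** * Size of the zeroes of a separable polynomial *)

Section Zeroes.

Variables (n : nat) (M : 'I_n.+1 -> 'M[int]_n.+1) (a : structure_constants n.+1).

(** Multiplication by the element with coordinates v, acting on rows. *)
Definition mult_mx (R : comNzRingType) (v : 'rV[R]_n.+1) : 'M[R]_n.+1 :=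
  \sum_i v 0 i *: map_mx intr (M i).

Hypothesis MM : forall i j, M i *m M j = \sum_k a i j k *: M k.
Hypothesis MC : forall i j, M i *m M j = M j *m M i.
Variable u : 'rV[int]_n.+1.
Hypothesis uM : forall i, u *m M i = delta_mx 0 i.

Lemma map_mult_mx (R S : comNzRingType) (g : {rmorphism R -> S}) (v : 'rV[R]_n.+1) :
  map_mx g (mult_mx v) = mult_mx (map_mx g v).
Proof.
rewrite raddf_sum; apply: eq_bigr => i _.
rewrite /= map_mxZ mxE -map_mx_comp; congr (_ *: _).
by apply: eq_map_mx => x /=; rewrite rmorph_int.
Qed.

Lemma mult_mxB (R : comNzRingType) (v w : 'rV[R]_n.+1) :
  mult_mx (v - w) = mult_mx v - mult_mx w.
Proof. by rewrite -sumrB; apply: eq_bigr => i _; rewrite !mxE scalerBl. Qed.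

(** An element is the image of the unit under its multiplication. *)
Lemma mult_mx_inj : injective (@mult_mx rat).
Proof.
move=> v w Evw; have E (x : 'rV[rat]_n.+1) : map_mx intr u *m mult_mx x = x.
  rewrite mulmx_sumr [RHS]row_sum_delta; apply: eq_bigr => i _.
  by rewrite -scalemxAr -map_mxM uM map_delta_mx.
by rewrite -(E v) Evw E.
Qed.

Lemma mult_mxM_gen (R : comNzRingType) i (w : 'rV[R]_n.+1) :
  map_mx intr (M i) *m mult_mx w = mult_mx (\row_k \sum_j w 0 j * (a i j k)%:~R).
Proof.
rewrite mulmx_sumr.
transitivity (\sum_j \sum_k (w 0 j * (a i j k)%:~R) *: (map_mx intr (M k) : 'M[R]_n.+1)).
  apply: eq_bigr => j _; rewrite -scalemxAr -map_mxM MM raddf_sum scaler_sumr.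
  by apply: eq_bigr => k _; rewrite /= map_mxZ scalerA.
rewrite exchange_big; apply: eq_bigr => k _ /=.
by rewrite mxE scaler_suml.
Qed.

Lemma mult_mxM (R : comNzRingType) (v w : 'rV[R]_n.+1) :
  exists z, mult_mx v *m mult_mx w = mult_mx z.
Proof.
exists (\sum_i v 0 i *: \row_k \sum_j w 0 j * (a i j k)%:~R).
rewrite {1}/mult_mx mulmx_suml.
under eq_bigr do rewrite -scalemxAl mult_mxM_gen.
rewrite /mult_mx; under eq_bigr do rewrite scaler_sumr.
rewrite exchange_big; apply: eq_bigr => k _ /=.
by rewrite summxE scaler_suml; apply: eq_bigr => i _; rewrite [in RHS]mxE scalerA.
Qed.

Lemma mult_mxC (R : comNzRingType) (v w : 'rV[R]_n.+1) :
  mult_mx v *m mult_mx w = mult_mx w *m mult_mx v.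
Proof.
rewrite /mult_mx mulmx_suml mulmx_sumr; under eq_bigr do rewrite mulmx_sumr.
under [RHS]eq_bigr do rewrite mulmx_suml.
apply: eq_bigr => i _; apply: eq_bigr => j _.
by rewrite -!scalemxAl -!scalemxAr -!map_mxM MC !scalerA mulrC.
Qed.

Lemma joint_triangularization : exists2 P : 'M[algC]_n.+1, P \in unitmx &
  forall v : 'rV[algC]_n.+1, trig P (mult_mx v).
Proof.
have [|P uniP /allP tP] :=
    @cotrigonalization algC _ [seq map_mx intr (M i) | i <- enum 'I_n.+1].
  by move=> _ _ /mapP[i _ ->] /mapP[j _ ->]; rewrite /comm_mx -!map_mxM MC.
have uP := unitarymx_unit uniP; exists P => // v.
apply: (trig_sum uP) => i; apply: trigZ.
by rewrite /trig /conj_by -conjumx //; apply: tP; apply: map_f; rewrite mem_enum.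
Qed.

Lemma mult_mx_delta (R : comNzRingType) i :
  mult_mx (delta_mx 0 i : 'rV[R]_n.+1) = map_mx intr (M i).
Proof.
rewrite /mult_mx (bigD1 i) //= big1 => [|j nij]; rewrite mxE eqxx ?eqxx ?scale1r ?addr0 //.
by rewrite (negPf nij) scale0r.
Qed.

(** The trace form detects nilpotency: all power sums of the characters of an
    element of its radical vanish. *)
Lemma trace_radical_nilpotent (v : 'rV[rat]_n.+1) :
  (forall j, \tr (mult_mx v *m map_mx intr (M j)) = 0) -> mult_mx v ^+ n.+1 = 0.
Proof.
move=> tr0; have [P uP tP] := joint_triangularization.
have tr0' w : \tr (mult_mx v *m mult_mx w) = 0.
  rewrite mulmx_sumr raddf_sum big1 // => i _.
  by rewrite /= -scalemxAr mxtraceZ tr0 mulr0.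
have pow k : exists w, mult_mx v ^+ k.+1 = mult_mx w.
  elim: k => [|k [w Ew]]; first by exists v.
  by have [z Ez] := mult_mxM v w; exists z; rewrite exprS Ew.
pose A : 'M[algC]_n.+1 := map_mx ratr (mult_mx v).
have AE : A = mult_mx (map_mx ratr v) by rewrite /A map_mult_mx.
have tA : trig P A by rewrite AE.
have powA k : A ^+ k = map_mx ratr (mult_mx v ^+ k) by rewrite rmorphXn.
have chi0 : forall i, chi P i A = 0.
  apply: power_sums_eq0 => [[|[|k]]] // _.
  under eq_bigr do rewrite -(proj2 (chi_pow uP _ _ tA)).
  rewrite -(tr_chi uP) powA; have [w Ew] := pow k.
  have tr0k : \tr (mult_mx v ^+ k.+2) = 0 by rewrite exprS Ew; apply: tr0'.
  by rewrite trace_map_mx tr0k rmorph0.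
have := chi_eq0_nilpotent uP tA chi0; rewrite powA => /eqP.
by rewrite map_mx_eq0 => /eqP.
Qed.

Lemma mx_size_le_map p q (C : 'M[int]_(p, q)) h (R : numDomainType) :
  mx_size_le C h -> mx_size_le (map_mx intr C : 'M[R]_(p, q)) h.
Proof.
move=> HC i j; rewrite mxE -intr_norm.
by have := HC i j; rewrite -(ler_int R) rmorphXn.
Qed.

Lemma mx_size_le_mult_mx (v : 'rV[rat]_n.+1) m h k : (n < m)%N ->
    (forall i, mx_size_le (M i) h) -> mx_size_le v k ->
  mx_size_le (mult_mx v) (m + (k + h)).
Proof.
move=> lt_m HM Hv i j; rewrite summxE; apply: norm_sum_le; first by rewrite card_ord.
move=> l; rewrite mxE normrM exprD ler_pM //.
exact: mx_size_le_map.
Qed.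

Lemma norm_tr_le (R : numDomainType) (A : 'M[R]_n.+1) m h : (n < m)%N ->
  mx_size_le A h -> `|\tr A| <= 2 ^+ (m + h).
Proof. by move=> lt_m HA; apply: norm_sum_le; rewrite ?card_ord. Qed.

Variables (f : {poly int}) (alpha : 'rV[int]_n.+1) (m r : nat).
Hypothesis lt_m : (n < m)%N.
Hypothesis HM : forall i, mx_size_le (M i) m.
Hypothesis f_alpha : horner_mx (mult_mx alpha) f = 0.
Hypothesis root_le : forall z : algC, root (map_poly intr f) z -> `|z| <= 2 ^+ r.

Local Notation alphaq := (map_mx intr alpha : 'rV[rat]_n.+1).

Lemma horner_mult_mx (R : comNzRingType) :
  horner_mx (mult_mx (map_mx intr alpha : 'rV[R]_n.+1)) (map_poly intr f) = 0.
Proof. by rewrite -map_mult_mx -map_horner_mx f_alpha raddf0. Qed.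

(** The trace is a sum of products of eigenvalues: those of alpha are roots of f,
    those of a basis element are bounded in terms of its entries. *)
Lemma trace_alpha_size j :
  `|\tr (mult_mx alphaq *m map_mx intr (M j))| <= 2 ^+ (m + (r + (m + m))).
Proof.
have [P uP tP] := joint_triangularization.
rewrite -(ler_rat algC) ratr_norm rmorphXn /= rmorph_nat -trace_map_mx map_mxM map_mult_mx.
have -> : map_mx ratr alphaq = map_mx intr alpha :> 'rV[algC]_n.+1.
  by rewrite -map_mx_comp; apply: eq_map_mx => x /=; rewrite rmorph_int.
have -> : map_mx ratr (map_mx intr (M j) : 'M[rat]_n.+1) = map_mx intr (M j) :> 'M[algC]_n.+1.
  by rewrite -map_mx_comp; apply: eq_map_mx => x /=; rewrite rmorph_int.
set A := mult_mx _; set B := map_mx _ _.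
have tA : trig P A by apply: tP.
have tB : trig P B by rewrite /B -mult_mx_delta; apply: tP.
rewrite (tr_chi uP); apply: norm_sum_le; first by rewrite card_ord.
move=> i; rewrite chiM // normrM exprD ler_pM //.
  apply: root_le; rewrite /root -(proj2 (trig_horner uP _ tA)) horner_mult_mx.
  by rewrite /chi /conj_by mulmx0 mul0mx mxE.
by apply: (chi_size uP) => //; apply: mx_size_le_map.
Qed.

(** A small solution beta of the linear system that the traces of alpha satisfy
    differs from alpha by a nilpotent element.  Newton's method doubles the order
    to which this element vanishes, so the number of rounds is logarithmic in the
    rank, and the d-fold growth of the sizes per round is polynomial in total. *)
Lemma zero_size (P : {poly rat}) (k d : nat) :
    horner_mx (mult_mx alphaq) P = mult_mx alphaq ->
    horner_mx (mult_mx alphaq) P^`() = 0 ->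
    (forall n (M : 'M[rat]_n.+1) m h t, (n < m)%N -> mx_size_le M h ->
      mx_size_le (iter t (fun M => horner_mx M P) M) (d ^ t * (h + m + k))) ->
  mx_size_le alpha (m + (m + ((2 * m) ^ d *
    (m + (m + (m + (m + (r + (m + m)) + (m * m + m * (m + (m + (m + m)))))) + m) + m + k)
    + (m * m + m * m)))).
Proof.
move=> Pa P'a HP; pose c := \row_j \tr (mult_mx alphaq *m map_mx intr (M j)).
pose T := \matrix_(i, j) \tr (M i *m M j).
have HT : mx_size_le T (m + (m + (m + m))).
  by move=> i j; rewrite mxE; apply: norm_tr_le => //; apply: mx_size_le_mul.
have TE (v : 'rV[rat]_n.+1) j : (v *m map_mx intr T) 0 j = \tr (mult_mx v *m map_mx intr (M j)).
  rewrite mxE mulmx_suml raddf_sum; apply: eq_bigr => i _ /=.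
  by rewrite !mxE -scalemxAl mxtraceZ -map_mxM trace_map_mx.
have Hc : mx_size_le c (m + (r + (m + m))).
  by move=> i j; rewrite mxE; apply: trace_alpha_size.
(* Any solution of this system determines alpha up to nilpotents. *)
have Ealpha : alphaq *m map_mx intr T = c by apply/rowP => j; rewrite TE mxE.
have [|beta Ebeta Hbeta] := bounded_solution HT Hc; first by exists alphaq.
have nil : mult_mx (beta - alphaq) ^+ (2 ^ up_log 2 n.+1) = 0.
  have /subnK <- : (n.+1 <= 2 ^ up_log 2 n.+1)%N by apply: up_logP.
  rewrite exprD trace_radical_nilpotent ?mulr0 // => j.
  by rewrite -TE mulmxBl Ebeta Ealpha subrr mxE.
have It := newton_iter Pa P'a (mult_mxC _ _) nil.
rewrite mult_mxB addrC subrK in It.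
have := HP _ _ _ _ (up_log 2 n.+1) lt_m (mx_size_le_mult_mx lt_m HM Hbeta).
rewrite It => Ha.
(* The second system expresses M_alpha by the matrices of the basis. *)
pose C : 'M[int]_(n.+1, n.+1 * n.+1) := \matrix_(i < n.+1) mxvec (M i).
have HC : mx_size_le C m.
  by move=> i j; rewrite mxE; apply: mx_size_le_mxvec (HM i) _ _.
have CE (v : 'rV[rat]_n.+1) : v *m map_mx intr C = mxvec (mult_mx v).
  apply/rowP; case/mxvec_indexP => j l.
  rewrite mxvecE summxE mxE; apply: eq_bigr => i _.
  by rewrite !mxE mxvecE.
have Hav := mx_size_le_mxvec Ha.
have [|y Ey Hy] := bounded_solution HC Hav; first by exists alphaq; rewrite CE.
have Ey' : y = alphaq.
  by apply: mult_mx_inj; apply: (can_inj mxvecK); rewrite -CE Ey.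
move=> i j; rewrite -(ler_int rat) rmorphXn intr_norm; have := Hy i j; rewrite Ey' mxE.
move/le_trans; apply; apply: exp2_le.
have le2m : (2 ^ up_log 2 n.+1 <= 2 * m)%N.
  case: (posnP n) lt_m => [->|n_gt0 ltnm]; first by rewrite up_log1 => /=; lia.
  have /andP[lt_n _] := up_log_bounds (ltnSn 1) (n_gt0 : (1 < n.+1)%N).
  have : (0 < up_log 2 n.+1)%N by rewrite up_log_gt0.
  move=> /prednK <-.
  by rewrite expnS leq_mul2l /=; apply: ltnW; apply: leq_trans lt_n ltnm.
have dle : (d ^ up_log 2 n.+1 <= (2 * m) ^ d)%N.
  apply: (@leq_trans ((2 ^ d) ^ up_log 2 n.+1)).
    by case: (up_log _ _) => // l; rewrite leq_exp2r // ltnW // ltn_expl.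
  rewrite -expnM mulnC expnM; case: (posnP d) => [->|d_gt0]; first by rewrite !expn0.
  by rewrite leq_exp2r.
have Hmm := leq_mul lt_m lt_m; have Hm k' : (n.+1 * k' <= m * k')%N by apply: leq_mul.
apply: leq_add => //; rewrite -addnA; do 2![apply: leq_add => //]; last by apply: leq_add.
apply: leq_mul dle _; have := Hm (m + (m + (m + m)))%N.
move: Hmm lt_m; move: (m * m)%N (n.+1 * n.+1)%N (m * _)%N (n.+1 * _)%N => x1 x2 x3 x4; clear; lia.
Qed.

End Zeroes.

(** * Orders given by structure constants *)

Definition mulv n (a : structure_constants n) (v w : 'rV[int]_n) : 'rV[int]_n :=
  \row_k \sum_i \sum_j v 0 i * w 0 j * a i j k.

Section Mulv.

Variables (n : nat) (a : structure_constants n).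

Lemma mulv_delta i j : mulv a (delta_mx 0 i) (delta_mx 0 j) = \row_k a i j k.
Proof.
apply/rowP => k; rewrite !mxE (bigD1 i) //= (bigD1 j) //= !mxE !eqxx !mul1r.
rewrite !big1 ?addr0 // => [i' ni|j' nj]; last by rewrite !mxE (negPf nj) andbF mulr0 mul0r.
by rewrite big1 // => j' _; rewrite !mxE (negPf ni) andbF !mul0r.
Qed.

Lemma mulvDl : left_distributive (mulv a) +%R.
Proof.
move=> u v w; apply/rowP => k; rewrite !mxE -big_split; apply: eq_bigr => i _ /=.
by rewrite -big_split; apply: eq_bigr => j _ /=; rewrite mxE !mulrDl.
Qed.

Lemma mulvDr : right_distributive (mulv a) +%R.
Proof.
move=> u v w; apply/rowP => k; rewrite !mxE -big_split; apply: eq_bigr => i _ /=.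
by rewrite -big_split; apply: eq_bigr => j _ /=; rewrite mxE mulrDr mulrDl.
Qed.

Lemma mulvZl c v w : mulv a (c *: v) w = c *: mulv a v w.
Proof.
apply/rowP => k; rewrite !mxE mulr_sumr; apply: eq_bigr => i _.
by rewrite mulr_sumr; apply: eq_bigr => j _; rewrite mxE -!mulrA.
Qed.

Lemma mulvZr c v w : mulv a v (c *: w) = c *: mulv a v w.
Proof.
apply/rowP => k; rewrite !mxE mulr_sumr; apply: eq_bigr => i _.
by rewrite mulr_sumr; apply: eq_bigr => j _; rewrite mxE -!mulrA mulrCA.
Qed.

Lemma mulv0l w : mulv a 0 w = 0.
Proof. by have := mulvZl 0 0 w; rewrite !scale0r. Qed.

Lemma mulv0r v : mulv a v 0 = 0.
Proof. by have := mulvZr 0 v 0; rewrite !scale0r. Qed.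

Lemma mulv_suml (I : finType) (F : I -> 'rV[int]_n) w :
  mulv a (\sum_i F i) w = \sum_i mulv a (F i) w.
Proof. by apply: (big_morph (mulv a ^~ w)) => [x y|]; [apply: mulvDl|apply: mulv0l]. Qed.

Lemma mulv_sumr (I : finType) (F : I -> 'rV[int]_n) v :
  mulv a v (\sum_i F i) = \sum_i mulv a v (F i).
Proof. by apply: (big_morph (mulv a v)) => [x y|]; [apply: mulvDr|apply: mulv0r]. Qed.

(** Used to reduce multilinear identities to the standard basis. *)
Lemma additive_ext (F G : 'rV[int]_n -> 'rV[int]_n) :
    (forall v w, F (v + w) = F v + F w) -> (forall c v, F (c *: v) = c *: F v) ->
    (forall v w, G (v + w) = G v + G w) -> (forall c v, G (c *: v) = c *: G v) ->
    (forall i, F (delta_mx 0 i) = G (delta_mx 0 i)) -> F =1 G.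
Proof.
move=> FD FZ GD GZ FG v; rewrite [v]row_sum_delta.
have F0 : F 0 = 0 by have := FZ 0 0; rewrite !scale0r.
have G0 : G 0 = 0 by have := GZ 0 0; rewrite !scale0r.
rewrite (big_morph F FD F0) (big_morph G GD G0); apply: eq_bigr => i _.
by rewrite FZ GZ FG.
Qed.

Definition is_order_table (u : 'rV[int]_n) : Prop :=
  [/\ forall i j k, a i j k = a j i k,
      forall i j l k, \sum_(h < n) a i j h * a h l k = \sum_(h < n) a j l h * a i h k
    & forall i, mulv a u (delta_mx 0 i) = delta_mx 0 i].

Lemma mulvC : (forall i j k, a i j k = a j i k) -> commutative (mulv a).
Proof.
move=> aC v w; apply/rowP => k; rewrite !mxE exchange_big; apply: eq_bigr => i _ /=.
by apply: eq_bigr => j _; rewrite aC [v 0 _ * _]mulrC.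
Qed.

Lemma row_mulvl i j l : mulv a (\row_k a i j k) (delta_mx 0 l) =
  \row_k \sum_(h < n) a i j h * a h l k.
Proof.
apply/rowP => k; rewrite !mxE; apply: eq_bigr => h _.
rewrite (bigD1 l) //= big1 ?addr0 => [|j' nj]; first by rewrite !mxE !eqxx mulr1.
by rewrite !mxE (negPf nj) andbF mulr0 mul0r.
Qed.

Lemma row_mulvr i j l : mulv a (delta_mx 0 i) (\row_k a j l k) =
  \row_k \sum_(h < n) a j l h * a i h k.
Proof.
apply/rowP => k; rewrite !mxE (bigD1 i) //= [X in _ + X]big1 ?addr0 => [|i' ni].
  by apply: eq_bigr => h _; rewrite !mxE !eqxx mul1r.
by rewrite big1 // => h _; rewrite !mxE (negPf ni) andbF !mul0r.
Qed.

Lemma mulvA u : is_order_table u -> associative (mulv a).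
Proof.
move=> [aC aA _] v1 v2 v3; move: v1 v2 v3.
have A3 i j l : mulv a (delta_mx 0 i) (mulv a (delta_mx 0 j) (delta_mx 0 l)) =
    mulv a (mulv a (delta_mx 0 i) (delta_mx 0 j)) (delta_mx 0 l).
  by rewrite !mulv_delta row_mulvl row_mulvr; apply/rowP => k; rewrite !mxE aA.
move=> v1 v2 v3; move: v1; apply: additive_ext; intros.
- exact: mulvDl.
- exact: mulvZl.
- by rewrite !mulvDl.
- by rewrite !mulvZl.
move: v2; apply: additive_ext => [v w|c v|v w|c v|j].
- by rewrite mulvDl mulvDr.
- by rewrite mulvZl mulvZr.
- by rewrite mulvDr mulvDl.
- by rewrite mulvZr mulvZl.
move: v3; apply: additive_ext => [v w|c v|v w|c v|l]; last exact: A3.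
- by rewrite !mulvDr.
- by rewrite !mulvZr.
- by rewrite mulvDr.
- by rewrite mulvZr.
Qed.

Lemma mul1v u : is_order_table u -> left_id u (mulv a).
Proof.
move=> [_ _ u1]; apply: additive_ext => // [v w|c v]; [exact: mulvDr|exact: mulvZr].
Qed.

End Mulv.

Lemma order_of_table n (a : structure_constants n) (u : 'rV[int]_n) :
    is_order_table a u ->
  exists (A : Zorder) (phi : {additive 'rV[int]_n -> A}),
    [/\ bijective phi, (forall v w, phi v * phi w = phi (mulv a v w)) & phi u = 1].
Proof.
move=> Hu; have [aC _ _] := Hu.
pose R : comPzRingType := HB.pack 'rV[int]_n
  (GRing.Zmodule_isComPzRing.Build 'rV[int]_n (mulvA Hu) (mulvC aC) (mul1v Hu) (@mulvDl _ a)).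
have Rn : exists (n : nat) (phi : {additive 'rV[int]_n -> R}), bijective phi.
  by exists n, (idfun : {additive 'rV[int]_n -> R}); exists id.
by exists (@ZOrder R Rn), (idfun : {additive 'rV[int]_n -> R}); split=> //; exists id.
Qed.

Definition powv n (a : structure_constants n) (u v : 'rV[int]_n) (t : nat) : 'rV[int]_n :=
  iter t (mulv a v) u.

Definition evalv n (a : structure_constants n) (u : 'rV[int]_n) (f : {poly int})
    (v : 'rV[int]_n) : 'rV[int]_n :=
  \sum_(t < size f) f`_t *: powv a u v t.

Lemma additiveZ n (A : zmodType) (phi : {additive 'rV[int]_n -> A}) (c : int) v :
  phi (c *: v) = phi v *~ c.
Proof. by rewrite -raddfMz -scaler_int intz. Qed.

Lemma is_zero_of_evalv n (a : structure_constants n) (A : Zorder)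
    (phi : {additive 'rV[int]_n -> A}) u f v :
    (forall v w, phi v * phi w = phi (mulv a v w)) -> phi u = 1 -> injective phi ->
  is_zero_of f (phi v) <-> evalv a u f v = 0.
Proof.
move=> phiM phi1 inj.
have phiX t : phi (powv a u v t) = phi v ^+ t.
  by elim: t => [|t IH] /=; rewrite ?phi1 // exprS -IH phiM.
suff E : phi (evalv a u f v) = \sum_(t < size f) phi v ^+ t *~ f`_t.
  rewrite /is_zero_of -E; split=> [|->]; last exact: raddf0.
  by move=> z; apply: inj; rewrite z raddf0.
by rewrite raddf_sum; apply: eq_bigr => t _ /=; rewrite additiveZ phiX.
Qed.

Lemma specified_mul n (a : structure_constants n) (A : comPzRingType)
    (phi : {additive 'rV[int]_n -> A}) :
    (forall i j : 'I_n, phi (delta_mx 0 i) * phi (delta_mx 0 j) =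
       \sum_(k < n) phi (delta_mx 0 k) *~ a i j k) ->
  forall v w, phi v * phi w = phi (mulv a v w).
Proof.
move=> phiM v w; rewrite [v]row_sum_delta [w]row_sum_delta.
rewrite !raddf_sum mulr_suml mulv_suml raddf_sum; apply: eq_bigr => i _ /=.
rewrite mulr_sumr mulv_sumr raddf_sum; apply: eq_bigr => j _ /=.
rewrite mulvZl mulvZr !additiveZ mulrzAl mulrzAr phiM mulv_delta; congr (_ *~ _ *~ _).
rewrite [\row_k _]row_sum_delta raddf_sum; apply: eq_bigr => k _ /=.
by rewrite additiveZ mxE.
Qed.

Lemma table_of_order n (a : structure_constants n) (A : comPzRingType)
    (phi : {additive 'rV[int]_n -> A}) u : bijective phi ->
    (forall v w, phi v * phi w = phi (mulv a v w)) -> phi u = 1 ->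
  is_order_table a u.
Proof.
move=> /bij_inj inj phiM phi1; split=> [i j k|i j l k|i].
- have /rowP/(_ k) : mulv a (delta_mx 0 i) (delta_mx 0 j) =
    mulv a (delta_mx 0 j) (delta_mx 0 i) by apply: inj; rewrite -!phiM mulrC.
  by rewrite !mulv_delta !mxE.
- have /rowP/(_ k) : mulv a (mulv a (delta_mx 0 i) (delta_mx 0 j)) (delta_mx 0 l) =
    mulv a (delta_mx 0 i) (mulv a (delta_mx 0 j) (delta_mx 0 l)).
    by apply: inj; rewrite -!phiM mulrA.
  by rewrite !mulv_delta row_mulvl row_mulvr !mxE.
- by apply: inj; rewrite -phiM phi1 mul1r.
Qed.

(** An order is determined by its table, which removes the quantification over
    rings. *)
Lemma root_problemP f w : root_problem f w <->
  exists n (a : structure_constants n) (u v : 'rV[int]_n),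
    [/\ w = encode_input a, is_order_table a u & evalv a u f v = 0].
Proof.
split=> [[n [a [A [-> [phi [bij_phi /= phiM]] [x fx]]]]]|[n [a [u [v [-> Hu fv]]]]]].
  have [psi phiK psiK] := bij_phi; have {}phiM := specified_mul phiM.
  exists n, a, (psi 1), (psi x); split=> //.
    exact: (table_of_order bij_phi phiM).
  by apply/(is_zero_of_evalv (A := A) _ _ phiM) => //; [apply: bij_inj|rewrite psiK].
have [A [phi [bij_phi phiM phi1]]] := order_of_table Hu.
exists n, a, A; split=> //; last first.
  by exists (phi v); apply/(is_zero_of_evalv (a := a) _ _ phiM phi1) => //; apply: bij_inj.
exists phi; split=> //= i j; rewrite phiM mulv_delta [\row_k _]row_sum_delta raddf_sum.
by apply: eq_bigr => k _; rewrite /= additiveZ mxE.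
Qed.

Lemma mulv_mult_mx n (a : structure_constants n.+1) v w :
  w *m mult_mx (fun i => \matrix_(j, k) a i j k) v = mulv a v w.
Proof.
rewrite mulmx_sumr; apply/rowP => k; rewrite summxE mxE; apply: eq_bigr => i _.
rewrite -scalemxAr mxE mxE mulr_sumr; apply: eq_bigr => j _.
by rewrite !mxE intz mulrA.
Qed.

Lemma row_mx_ext n (B C : 'M[int]_n) : (forall w : 'rV_n, w *m B = w *m C) -> B = C.
Proof. by move=> E; apply/row_matrixP => i; rewrite !rowE E. Qed.

Theorem order_zero_size f : separable_int_poly f -> exists Q : {poly nat},
  forall n (a : structure_constants n) (u v : 'rV[int]_n) m,
    (n <= m)%N -> (forall i j k, `|a i j k| <= 2 ^+ m) ->
    is_order_table a u -> evalv a u f v = 0 -> mx_size_le v Q.[m].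
Proof.
move=> sep_f; have [P HP] := newton_polynomial sep_f.
have [r Hr] := root_size sep_f; have [k [d HPkd]] := mx_size_le_iter P.
have [Q HQ] : poly_bounded (fun m => m + (m + ((2 * m) ^ d *
    (m + (m + (m + (m + (r + (m + m)) + (m * m + m * (m + (m + (m + m)))))) + m) + m + k)
    + (m * m + m * m))))%N by poly_bound.
exists Q => -[|n] a u v m le_m Ha Hu fv; first by move=> ? [].
pose M i : 'M[int]_n.+1 := \matrix_(j, l) a i j l.
have [aC aA u1] := Hu.
have Mmul i w : w *m M i = mulv a (delta_mx 0 i) w.
  rewrite -mulv_mult_mx mult_mx_delta; congr (_ *m _).
  by apply/matrixP => j l; rewrite !mxE intz.
have MC i j : M i *m M j = M j *m M i.
  apply: row_mx_ext => w; rewrite !mulmxA !Mmul !(mulvA Hu).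
  by rewrite (mulvC aC (delta_mx 0 j)).
have MM i j : M i *m M j = \sum_l a i j l *: M l.
  apply: row_mx_ext => w; rewrite MC mulmxA !Mmul (mulvA Hu) mulv_delta.
  rewrite mulmx_sumr [\row_l _]row_sum_delta mulv_suml; apply: eq_bigr => l _.
  by rewrite -scalemxAr Mmul mulvZl mxE.
have uM i : u *m M i = delta_mx 0 i by rewrite Mmul (mulvC aC) u1.
have f_mult : horner_mx (mult_mx M v) f = 0.
  apply: row_mx_ext => w; rewrite mulmx0.
  rewrite -[f]coefK poly_def rmorph_sum mulmx_sumr.
  rewrite -[RHS](mulv0l a w) -[in RHS]fv /evalv mulv_suml.
  apply: eq_bigr => t _; rewrite -mul_polyC rmorphM /= horner_mx_C rmorphXn /= horner_mx_X.
  rewrite -[_ * _]/(_ *m _) mul_scalar_mx -scalemxAr mulvZl; congr (_ *: _).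
  elim: (t : nat) w => [|t' IH] w /=; first by rewrite expr0 mulmx1 (mul1v Hu).
  rewrite exprSr -[_ * _]/(_ *m _) mulmxA IH mulv_mult_mx.
  by rewrite -!(mulvA Hu).
have [] := HP n (mult_mx M (map_mx intr v)).
  by rewrite -map_mult_mx -map_horner_mx f_mult raddf0.
move=> Pa P'a.
apply: mx_size_leW (HQ m).
apply: (zero_size MM MC uM le_m _ f_mult Hr Pa P'a HPkd).
by move=> i j l; rewrite mxE.
Qed.

Lemma separable_linear : separable_int_poly ('X - 1%:P).
Proof.
move=> z; rewrite /double_root map_polyXsubC => /dvdp_leq.
by rewrite polyXsubC_eq0 size_exp_XsubC size_XsubC => /(_ isT).
Qed.

(** This makes the bound for zeroes apply to the coordinates of the unit. *)
Lemma evalv_unit n (a : structure_constants n) u : is_order_table a u ->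
  evalv a u ('X - 1%:P) u = 0.
Proof.
move=> Hu; rewrite /evalv size_XsubC !big_ord_recl big_ord0 /=.
rewrite !(coefB, coefX, coefC) /= (mul1v Hu) addr0 -scalerDl.
by rewrite sub0r subr0 addNr scale0r.
Qed.

Local Close Scope ring_scope.

(** * The certificate *)

(** The leading zeroes that are removed are restored by the default digit 0. *)
Lemma nth_bits_value w i : nth false (bits (value w)) i = nth false w i.
Proof.
elim: w i => [|b w IH] i; first by rewrite bits0.
rewrite -[value _]/(b + (value w).*2) bitsS; case: eqP => [E|_]; last by case: i => //=.
move/eqP: (E); rewrite addn_eq0 double_eq0 => /andP[/eqP b0 /eqP v0].
case: i => [|i] /=; first by case: (b) b0.
by rewrite -IH v0 bits0 !nth_nil.
Qed.

Section Words.

Variables O W : env -> nat.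
Hypotheses (HO : arith O) (HW : arith W).

Let v e := value (take (W e) (drop (O e) (cert e))).

Lemma window_le e : size (bits (v e)) <= size (word true e).
Proof.
apply: size_bits_le; apply: leq_trans (value_lt _) _.
by rewrite leq_exp2l // size_take_min size_drop /=; lia.
Qed.

Lemma ariths_bits_window : ariths (fun e => bits (v e)).
Proof.
have Hv : arith v := arith_window HO HW.
split.
  pose G e i := (2 ^ minn i (size (cert e)) <= v e : nat).
  have HG : arith (fun e => G (pop (pop e)) (top e)).
    by apply: arithb_leq; [exact: (arith_pow2 true ArithTop)|exact: arith_lift].
  apply: arith_ext (@arith_sum true _ (arith_size true) _ G HG) => // e /=.
  rewrite -[RHS]card_ord -sum1_card (big_ord_widen _ (fun=> 1) (window_le e)).
  rewrite [RHS]big_mkcond; apply: eq_bigr => i _; rewrite /G.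
  rewrite (minn_idPl (ltnW (ltn_ord i))).
  have -> : (2 ^ i <= v e) = (i < size (bits (v e))); last by case: ltnP.
  apply/idP/idP => [le_i|lt_i]; last first.
    have [|lt_v] := leqP (2 ^ i) (v e) => //.
    by have := leq_trans lt_i (size_bits_le lt_v); rewrite ltnn.
  by rewrite -(ltn_exp2l (m := 2)) //; apply: leq_ltn_trans le_i (lt_size_bits _).
have Hr := ArithAdd (ArithPop HO) ArithTop.
apply: arithb_ext (arithb_and (arithb_ltn ArithTop (ArithPop HW)) (arith_nth true Hr)) => e.
rewrite nth_bits_value; case: ltnP => [ltW|leW] /=; first by rewrite nth_take // nth_drop.
by rewrite nth_default // size_take_min; lia.
Qed.

Lemma ariths_encode_window : ariths (fun e => encode_nat (v e)).
Proof.
have Hb := ariths_bits_window; have [Hs _] := Hb.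
have Hg := substitution_pop (substitution_pop substitution_id).
pose G e i := [:: true] ++ [:: nth false (bits (v e)) i].
have HG : ariths (fun e => G (pop (pop e)) (top e)).
  apply: ariths_cat; apply: ariths_digit; first exact: ArithOne.
  exact: (ariths_nth Hb Hg ArithTop).
have Hf : ariths (fun=> [:: false]) by apply: ariths_digit; apply: arith0.
apply: ariths_ext (ariths_cat (ariths_flatten Hs window_le HG) Hf) => e.
rewrite /encode_nat; congr (flatten _ ++ _); rewrite -[in RHS](mkseq_nth false (bits (v e))).
by rewrite /mkseq -map_comp.
Qed.

End Words.

Section Certificate.

Variable Q : {poly nat}.

(** A certificate starts with the rank in unary, padded to the length of the
    input, and continues with integers of a fixed width, sign first.  The unary
    form makes the rank at most the length of the input by definition, so that
    loops up to the rank are loops over the input. *)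
Definition rank (x u : seq bool) : nat := \sum_(i < size x) nth false u i.

Definition slot (x u : seq bool) (t : nat) : nat := size x + t * Q.[size x]%R.+1.

Definition magnitude (x u : seq bool) (t : nat) : nat :=
  value (take Q.[size x]%R (drop (slot x u t).+1 u)).

Definition integer (x u : seq bool) (t : nat) : int :=
  ((-1) ^+ nth false u (slot x u t) * (magnitude x u t)%:Z)%R.

Definition table (x u : seq bool) (i j k : nat) : int :=
  let n := rank x u in integer x u (1 + ((i * n + j) * n + k)).

Definition unit_coord (x u : seq bool) (k : nat) : int :=
  let n := rank x u in integer x u (1 + n ^ 3 + k).

Definition zero_coord (x u : seq bool) (k : nat) : int :=
  let n := rank x u in integer x u (1 + n ^ 3 + n + k).

Lemma rank_le x u : rank x u <= size x.
Proof.
rewrite -[leqRHS]muln1 -[X in X * _]card_ord -sum_nat_const; apply: leq_sum => i _.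
by case: nth.
Qed.

Lemma arith_rank : arith (fun e => rank (input e) (cert e)).
Proof.
apply: arith_ext (@arith_sum false _ (arith_size false) _
  (fun e i => nth false (cert e) i) _) => //.
exact: (arith_nth true ArithTop).
Qed.

Lemma rank_word e : rank (input e) (cert e) <= size (word false e).
Proof. exact: rank_le. Qed.

Lemma arith_width : arith (fun e => Q.[size (input e)]%R).
Proof. exact: arith_horner (arith_size false). Qed.

Lemma arith_slot I : arith I -> arith (fun e => slot (input e) (cert e) (I e)).
Proof.
move=> HI; apply: ArithAdd (arith_size false) _; apply: ArithMul HI _.
by apply: arith_ext (ArithAdd ArithOne arith_width).
Qed.

Lemma arith_slotS I : arith I -> arith (fun e => (slot (input e) (cert e) (I e)).+1).
Proof. by move=> HI; apply: arith_ext (ArithAdd ArithOne (arith_slot HI)). Qed.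

Lemma arith_magnitude I : arith I -> arith (fun e => magnitude (input e) (cert e) (I e)).
Proof. by move=> HI; apply: arith_window (arith_slotS HI) arith_width. Qed.

Lemma arithb_sign I : arith I ->
  arithb (fun e => nth false (cert e) (slot (input e) (cert e) (I e))).
Proof. by move=> HI; apply: (arith_nth true); apply: arith_slot. Qed.

Lemma arithz_integer I : arith I -> arithz (fun e => integer (input e) (cert e) (I e)).
Proof.
move=> HI; have Hs := arithb_sign HI; have Hm := arith_magnitude HI.
have HP := ArithMul (ArithSub ArithOne Hs) Hm; have HN := ArithMul Hs Hm.
refine (ex_intro _ _ (ex_intro _ _ (And3 HP HN _))) => e; move: HP HN => _ _.
by rewrite /integer; case: nth => /=; lia.
Qed.

Lemma ariths_encode_magnitude I : arith I ->
  ariths (fun e => encode_nat (magnitude (input e) (cert e) (I e))).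
Proof. by move=> HI; apply: ariths_encode_window (arith_slotS HI) arith_width. Qed.

Lemma ariths_encode_integer I : arith I ->
  ariths (fun e => encode_int (integer (input e) (cert e) (I e))).
Proof.
move=> HI; have Hs := arithb_sign HI; have Hm := arith_magnitude HI.
apply: ariths_ext (ariths_cat (ariths_digit (arithb_and Hs
  (arithb_ltn arith0 Hm))) (ariths_encode_magnitude HI)) => e.
rewrite /encode_int /integer abszMsign absz_nat cat1s; congr (_ :: _).
by case: nth => /=; case: (magnitude _ _ _) => [|v]; rewrite ?mul1r ?mulN1r.
Qed.

Lemma arith_table_index I J K : arith I -> arith J -> arith K ->
  arith (fun e => let n := rank (input e) (cert e) in 1 + ((I e * n + J e) * n + K e)).
Proof.
move=> HI HJ HK; have Hr := arith_rank.
by do ?[exact: ArithOne|assumption|apply: ArithAdd|apply: ArithMul].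
Qed.

Lemma arithz_table I J K : arith I -> arith J -> arith K ->
  arithz (fun e => table (input e) (cert e) (I e) (J e) (K e)).
Proof. by move=> HI HJ HK; apply: arithz_integer (arith_table_index HI HJ HK). Qed.

Lemma arith_rank3 : arith (fun e => 1 + rank (input e) (cert e) ^ 3).
Proof.
have Hr := arith_rank; apply: ArithAdd ArithOne _.
by apply: arith_ext (ArithMul Hr (ArithMul Hr Hr)) => e; rewrite !expnS muln1.
Qed.

Lemma arithz_unit I : arith I -> arithz (fun e => unit_coord (input e) (cert e) (I e)).
Proof. by move=> HI; apply: arithz_integer (ArithAdd arith_rank3 HI). Qed.

Lemma arithz_zero I : arith I -> arithz (fun e => zero_coord (input e) (cert e) (I e)).
Proof. by move=> HI; apply: arithz_integer (ArithAdd (ArithAdd arith_rank3 arith_rank) HI). Qed.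

End Certificate.

(** * The verifier *)

Definition mulz (n : nat) (A : nat -> nat -> nat -> int) (v w : nat -> int) (k : nat) : int :=
  (\sum_(0 <= i < n) \sum_(0 <= j < n) v i * w j * A i j k)%R.

Definition powz n A (u v : nat -> int) (t : nat) : nat -> int := iter t (mulz n A v) u.

Definition all_below (n : nat) (B : nat -> bool) : bool := all B (iota 0 n).

Definition valid (f : {poly int}) n A (u v : nat -> int) : bool :=
  [&& all_below n (fun i => all_below n (fun j => all_below n (fun k =>
        A i j k == A j i k))),
      all_below n (fun i => all_below n (fun j => all_below n (fun l => all_below n (fun k =>
        \sum_(0 <= h < n) A i j h * A h l k == \sum_(0 <= h < n) A j l h * A i h k)))),
      all_below n (fun i => all_below n (fun k =>
        \sum_(0 <= h < n) u h * A h i k == (i == k : nat)%:Z))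
    & all_below n (fun k =>
        \sum_(t <- iota 0 (size f)) f`_t * powz n A u v t k == 0)]%R.

Lemma all_belowP n (B : nat -> bool) : reflect (forall i : 'I_n, B i) (all_below n B).
Proof.
apply: (iffP allP) => [H i|H i]; first by apply: H; rewrite mem_iota /=.
by rewrite mem_iota => /= lti; apply: (H (Ordinal lti)).
Qed.

Section Valid.

Variables (f : {poly int}) (n : nat) (A : nat -> nat -> nat -> int) (u v : nat -> int).

Local Notation a := (fun i j k : 'I_n => A i j k).
Local Notation row z := (\row_(k < n) z (k : nat))%R.

Lemma mulz_mulv x y (k : 'I_n) : mulz n A x y k = mulv a (row x) (row y) 0%R k.
Proof.
rewrite /mulz mxE big_mkord; apply: eq_bigr => i _; rewrite big_mkord.
by apply: eq_bigr => j _; rewrite !mxE.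
Qed.

Lemma powz_powv t (k : 'I_n) : powz n A u v t k = powv a (row u) (row v) t 0%R k.
Proof.
elim: t k => [|t IH] k /=; first by rewrite mxE.
rewrite mulz_mulv; congr (mulv _ _ _ _ _); apply/rowP => j.
by rewrite mxE IH.
Qed.

Lemma validP : valid f n A u v <->
  is_order_table a (row u) /\ evalv a (row u) f (row v) = 0%R.
Proof.
have Eu (i k : 'I_n) : (mulv a (row u) (delta_mx 0 i) 0 k = \sum_(0 <= h < n) u h * A h i k)%R.
  rewrite mxE big_mkord; apply: eq_bigr => h _.
  rewrite (bigD1 i) //= big1 ?addr0 => [|j nj]; first by rewrite !mxE !eqxx mulr1.
  by rewrite !mxE (negPf nj) andbF mulr0 mul0r.
have Ef (k : 'I_n) : evalv a (row u) f (row v) 0%R k =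
    (\sum_(t <- iota 0 (size f)) f`_t * powz n A u v t k)%R.
  have -> : iota 0 (size f) = index_iota 0 (size f) by rewrite /index_iota subn0.
  rewrite summxE big_mkord; apply: eq_bigr => t _.
  by rewrite mxE powz_powv.
split=> [/and4P[/all_belowP aC /all_belowP aA /all_belowP aU /all_belowP aF]|[[aC aA aU] aF]].
  split; last by apply/rowP => k; rewrite Ef mxE; apply/eqP.
  split=> [i j k|i j l k|i].
  - by have /all_belowP/(_ j)/all_belowP/(_ k)/eqP := aC i.
  - have /all_belowP/(_ j)/all_belowP/(_ l)/all_belowP/(_ k)/eqP := aA i.
    by rewrite !big_mkord.
  - apply/rowP => k; rewrite Eu mxE eqxx /= eq_sym.
    have /all_belowP/(_ k)/eqP -> := aU i.
    by rewrite -val_eqE /=; case: eqP.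
apply/and4P; split; apply/all_belowP => i.
- by apply/all_belowP => j; apply/all_belowP => k; apply/eqP; apply: aC.
- apply/all_belowP => j; apply/all_belowP => l; apply/all_belowP => k.
  by apply/eqP; rewrite !big_mkord; apply: aA.
- apply/all_belowP => k; apply/eqP; rewrite -Eu aU mxE eqxx /= eq_sym -val_eqE /=.
  by case: eqP.
- by apply/eqP; rewrite -Ef aF mxE.
Qed.

End Valid.

Definition encoded_table (n : nat) (A : nat -> nat -> nat -> int) : seq bool :=
  flatten [seq flatten [seq flatten [seq encode_int (A i j k)
    | k <- iota 0 n] | j <- iota 0 n] | i <- iota 0 n].

Lemma bigcat_iota n (G : nat -> seq bool) :
  \big[cat/[::]]_(i < n) G i = flatten [seq G i | i <- iota 0 n].
Proof.
elim: n => [|n IH]; first by rewrite big_ord0.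
by rewrite big_ord_recr IH -[in RHS]addn1 iotaD map_cat flatten_cat /= cats0.
Qed.

Lemma encode_inputE n (A : nat -> nat -> nat -> int) :
  encode_input (fun i j k : 'I_n => A i j k) =
  encode_nat n ++ encoded_table n A.
Proof.
rewrite /encode_input /encoded_table; congr (_ ++ _).
rewrite -bigcat_iota; apply: eq_bigr => i _; rewrite -bigcat_iota.
by apply: eq_bigr => j _; rewrite -bigcat_iota.
Qed.

Section Verifier.

Variables (Q : {poly nat}) (f : {poly int}).

(** The first integer repeats the rank in binary, so that its code is available
    digit by digit like the other ones. *)
Definition verifier (x u : seq bool) : bool :=
  let n := rank x u in
  [&& magnitude Q x u 0 == n,
      x == encode_nat (magnitude Q x u 0) ++ encoded_table n (table Q x u)
    & valid f n (table Q x u) (unit_coord Q x u) (zero_coord Q x u)].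

Let n e := rank (input e) (cert e).

Lemma arithb_all_below (B : env -> nat -> bool) :
    arithb (fun e => B (pop (pop e)) (top e)) ->
  arithb (fun e => all_below (n e) (B e)).
Proof. exact: (arithb_all arith_rank rank_word). Qed.

Lemma arithz_sum_rank (Z : env -> nat -> int) :
    arithz (fun e => Z (pop (pop e)) (top e)) ->
  arithz (fun e => \sum_(0 <= i < n e) Z e i)%R.
Proof. exact: (arithz_sum arith_rank rank_word). Qed.

Lemma ariths_flatten_rank (G : env -> nat -> seq bool) :
    ariths (fun e => G (pop (pop e)) (top e)) ->
  ariths (fun e => flatten [seq G e i | i <- iota 0 (n e)]).
Proof. exact: (ariths_flatten arith_rank rank_word). Qed.

(* The positions bound by the enclosing loops, the innermost first. *)
Let x0 := ArithTop.
Let x1 := arith_lift x0.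
Let x2 := arith_lift x1.
Let x3 := arith_lift x2.
Let x4 := arith_lift x3.

Lemma ariths_encoded_table :
  ariths (fun e => encoded_table (n e) (table Q (input e) (cert e))).
Proof.
apply: (ariths_flatten_rank (G := fun e i => flatten [seq flatten [seq encode_int
  (table Q (input e) (cert e) i j k) | k <- iota 0 (n e)] | j <- iota 0 (n e)])).
apply: (ariths_flatten_rank (G := fun e j => flatten [seq encode_int
  (table Q (input e) (cert e) (top e) j k) | k <- iota 0 (n e)])).
apply: (ariths_flatten_rank (G := fun e k => encode_int
  (table Q (input e) (cert e) (top (pop (pop e))) (top e) k))).
exact (ariths_encode_integer Q (arith_table_index x2 x1 x0)).
Qed.

Lemma arithz_powz t I : arith I -> arithz (fun e => powz (n e) (table Q (input e) (cert e))
  (unit_coord Q (input e) (cert e)) (zero_coord Q (input e) (cert e)) t (I e)).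
Proof.
elim: t I => [|t IH] I HI; first exact: arithz_unit.
apply: (arithz_sum_rank (Z := fun e i => \sum_(0 <= j < n e)
  zero_coord Q (input e) (cert e) i * powz (n e) (table Q (input e) (cert e))
  (unit_coord Q (input e) (cert e)) (zero_coord Q (input e) (cert e)) t j *
  table Q (input e) (cert e) i j (I e))%R).
apply: (arithz_sum_rank (Z := fun e j => zero_coord Q (input e) (cert e) (top e) *
  powz (n e) (table Q (input e) (cert e))
  (unit_coord Q (input e) (cert e)) (zero_coord Q (input e) (cert e)) t j *
  table Q (input e) (cert e) (top e) j (I (pop (pop e))))%R).
apply: arithz_mul; last exact: (arithz_table Q x1 x0 (arith_lift (arith_lift HI))).
by apply: arithz_mul; [exact: (arithz_zero Q x1)|exact: (IH _ x0)].
Qed.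

Lemma arithb_valid : arithb (fun e => valid f (n e) (table Q (input e) (cert e))
  (unit_coord Q (input e) (cert e)) (zero_coord Q (input e) (cert e))).
Proof.
apply: arithb_and; last apply: arithb_and; last apply: arithb_and.
- apply: (arithb_all_below (B := fun e i => all_below (n e) (fun j => all_below (n e)
    (fun k => table Q (input e) (cert e) i j k == table Q (input e) (cert e) j i k)))).
  apply: (arithb_all_below (B := fun e j => all_below (n e) (fun k =>
    table Q (input e) (cert e) (top e) j k == table Q (input e) (cert e) j (top e) k))).
  apply: (arithb_all_below (B := fun e k =>
    table Q (input e) (cert e) (top (pop (pop e))) (top e) k ==
    table Q (input e) (cert e) (top e) (top (pop (pop e))) k)).
  exact: (arithb_eqz (arithz_table Q x2 x1 x0) (arithz_table Q x1 x2 x0)).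
- pose A e := table Q (input e) (cert e).
  pose i1 e := top e; pose i2 e := top (pop (pop e)).
  pose i3 e := top (pop (pop (pop (pop e)))).
  apply: (arithb_all_below (B := fun e i => all_below (n e) (fun j => all_below (n e)
    (fun l => all_below (n e) (fun k => \sum_(0 <= h < n e) A e i j h * A e h l k ==
      \sum_(0 <= h < n e) A e j l h * A e i h k))))%R).
  apply: (arithb_all_below (B := fun e j => all_below (n e)
    (fun l => all_below (n e) (fun k => \sum_(0 <= h < n e) A e (i1 e) j h * A e h l k ==
      \sum_(0 <= h < n e) A e j l h * A e (i1 e) h k)))%R).
  apply: (arithb_all_below (B := fun e l => all_below (n e)
    (fun k => \sum_(0 <= h < n e) A e (i2 e) (i1 e) h * A e h l k ==
      \sum_(0 <= h < n e) A e (i1 e) l h * A e (i2 e) h k))%R).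
  apply: (arithb_all_below (B := fun e k =>
      \sum_(0 <= h < n e) A e (i3 e) (i2 e) h * A e h (i1 e) k ==
      \sum_(0 <= h < n e) A e (i2 e) (i1 e) h * A e (i3 e) h k)%R).
  apply: arithb_eqz.
    apply: (arithz_sum_rank (Z := fun e h => A e (i3 (pop (pop e))) (i3 e) h *
      A e h (i2 e) (i1 e))%R).
    exact: (arithz_mul (arithz_table Q x4 x3 x0) (arithz_table Q x0 x2 x1)).
  apply: (arithz_sum_rank (Z := fun e h => A e (i3 e) (i2 e) h *
    A e (i3 (pop (pop e))) h (i1 e))%R).
  exact: (arithz_mul (arithz_table Q x3 x2 x0) (arithz_table Q x4 x0 x1)).
- apply: (arithb_all_below (B := fun e i => all_below (n e) (fun k =>
    \sum_(0 <= h < n e) unit_coord Q (input e) (cert e) h *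
      table Q (input e) (cert e) h i k == (i == k : nat)%:Z))%R).
  apply: (arithb_all_below (B := fun e k =>
    \sum_(0 <= h < n e) unit_coord Q (input e) (cert e) h *
      table Q (input e) (cert e) h (top e) k == (top e == k : nat)%:Z)%R).
  apply: arithb_eqz; last exact: (arithz_nat (arithb_eq x1 x0)).
  apply: (arithz_sum_rank (Z := fun e h => unit_coord Q (input e) (cert e) h *
      table Q (input e) (cert e) h (top (pop (pop e))) (top e))%R).
  exact: (arithz_mul (arithz_unit Q x0) (arithz_table Q x0 x2 x1)).
apply: (arithb_all_below (B := fun e k => \sum_(t <- iota 0 (size f)) f`_t *
  powz (n e) (table Q (input e) (cert e))
    (unit_coord Q (input e) (cert e)) (zero_coord Q (input e) (cert e)) t k == 0)%R).
apply: arithb_eqz; last exact: arithz_const.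
apply: (@arithz_fsum _ _ (fun e t => f`_t * powz (n e) (table Q (input e) (cert e))
    (unit_coord Q (input e) (cert e)) (zero_coord Q (input e) (cert e)) t (top e))%R) => t.
exact: (arithz_mul (arithz_const _) (arithz_powz t x0)).
Qed.

Theorem poly_time_verifier : poly_time verifier.
Proof.
have H : arithb (fun e => verifier (input e) (cert e)).
  apply: arithb_and; first exact: (arithb_eq (arith_magnitude Q arith0) arith_rank).
  apply: arithb_and arithb_valid.
  apply: (@arithb_eqs false (word false)) => //; first exact: ariths_word.
  exact: ariths_cat (ariths_encode_magnitude Q arith0) ariths_encoded_table.
exact: poly_time_arith H _.
Qed.

End Verifier.

Lemma verifier_sound Q f x u : verifier Q f x u -> root_problem f x.
Proof.
case/and3P=> /eqP En /eqP Ex /validP[Ht Hz].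
apply/root_problemP; exists (rank x u), (fun i j k => table Q x u i j k).
exists (\row_k unit_coord Q x u k)%R, (\row_k zero_coord Q x u k)%R; split=> //.
by rewrite encode_inputE [LHS]Ex En.
Qed.

(** * Small certificates *)

Definition fixed_width (W : nat) (z : int) : seq bool :=
  (z < 0)%R :: mkseq (fun i => odd (`|z| %/ 2 ^ i)) W.

Definition make_certificate (m n W : nat) (zs : seq int) : seq bool :=
  mkseq (ltn^~ n) m ++ flatten [seq fixed_width W z | z <- zs].

Lemma value_mkseq_odd W v : v < 2 ^ W -> value (mkseq (fun i => odd (v %/ 2 ^ i)) W) = v.
Proof.
elim: W v => [|W IH] v lt_v; first by case: v lt_v.
rewrite /mkseq /= expn0 divn1 -[1]/(1 + 0) iotaDl -map_comp.
rewrite (eq_map (g := fun i => odd (v./2 %/ 2 ^ i))) => [|i]; last first.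
  by rewrite /= add1n expnS divnMA divn2.
by rewrite IH ?odd_double_half //; move: lt_v; rewrite expnS; lia.
Qed.

Section Decode.

Variables (Q : {poly nat}) (x : seq bool) (n : nat) (zs : seq int).
Let m := size x.
Let W := Q.[m]%R.
Let u := make_certificate m n W zs.
Hypothesis le_n : n <= m.
Hypothesis zs_small : forall z, z \in zs -> absz z < 2 ^ W.

Lemma size_certificate : size u = m + size zs * W.+1.
Proof.
rewrite size_cat size_mkseq; congr (_ + _); elim: (zs) => //= z s IH.
by rewrite size_cat IH /= size_map size_iota mulSn.
Qed.

Lemma rank_certificate : rank x u = n.
Proof.
rewrite /rank -/m; transitivity (\sum_(i < m) (i < n : nat)).
  by apply: eq_bigr => i _; rewrite nth_cat size_mkseq ltn_ord nth_mkseq.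
rewrite -{2}(card_ord n) -sum1_card (big_ord_widen _ (fun=> 1) le_n) [RHS]big_mkcond.
by apply: eq_bigr => i _; case: ltnP.
Qed.

Lemma drop_certificate t : t < size zs -> exists w,
  drop (slot Q x u t) u = fixed_width W (nth 0%R zs t) ++ w.
Proof.
move=> lt_t; rewrite /slot -/m -/W addnC -drop_drop drop_size_cat ?size_mkseq //.
elim: (zs) t lt_t => //= z s IH [|t] lt_t.
  by rewrite mul0n drop0; eexists.
have [w Ew] := IH t lt_t; exists w; rewrite -Ew mulSn addnC -drop_drop.
by rewrite -cat_cons drop_size_cat //= size_map size_iota.
Qed.

Lemma magnitude_certificate t : t < size zs -> magnitude Q x u t = absz (nth 0%R zs t).
Proof.
move=> lt_t; have [w Ew] := drop_certificate lt_t.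
rewrite /magnitude -add1n -drop_drop Ew /= drop0 take_size_cat ?size_mkseq //.
by rewrite value_mkseq_odd //; apply: zs_small; apply: mem_nth.
Qed.

Lemma integer_certificate t : t < size zs -> integer Q x u t = nth 0%R zs t.
Proof.
move=> lt_t; have [w Ew] := drop_certificate lt_t.
rewrite /integer magnitude_certificate // -[slot _ _ _ _]addn0 -nth_drop Ew /=.
by case: (nth 0%R zs t) => v /=; rewrite ?mul1r // NegzE mulN1r.
Qed.

End Decode.

Definition extend n (T : Type) (z : T) (g : 'I_n -> T) (t : nat) : T :=
  if insub t is Some i then g i else z.

Lemma extendE n T (z : T) (g : 'I_n -> T) (i : 'I_n) : extend z g i = g i.
Proof. by rewrite /extend valK. Qed.

Section Complete.

Variables (Q : {poly nat}) (f : {poly int}) (n : nat) (a : structure_constants n).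
Variables u v : 'rV[int]_n.

Let m := size (encode_input a).
Let A i j k := extend 0%R (fun i => extend 0%R (fun j => extend 0%R (a i j) k) j) i.

Lemma extend_table (i j k : 'I_n) : A i j k = a i j k.
Proof. by rewrite /A !extendE. Qed.

Lemma encode_extend : encode_input a = encode_nat n ++ encoded_table n A.
Proof.
rewrite -encode_inputE; congr encode_input.
by do 3![apply: functional_extensionality => ?]; rewrite extend_table.
Qed.

Lemma size_entry (i j k : 'I_n) : size (encode_int (a i j k)) <= m.
Proof.
rewrite /m encode_extend size_cat; apply: leq_trans (leq_addl _ _).
rewrite size_flatten_iota (bigD1 i) //=; apply: leq_trans (leq_addr _ _).
rewrite size_flatten_iota (bigD1 j) //=; apply: leq_trans (leq_addr _ _).
rewrite size_flatten_iota (bigD1 k) //=; apply: leq_trans (leq_addr _ _).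
by rewrite extend_table.
Qed.

Lemma entry_lt i j k : absz (a i j k) < 2 ^ m.
Proof.
apply: leq_trans (lt_size_bits _) _; rewrite leq_exp2l //.
apply: leq_trans (size_entry i j k); rewrite /= size_cat.
have E s : size (flatten [seq [:: true; b] | b <- s]) = (size s).*2.
  by elim: s => //= b s ->.
by rewrite E; lia.
Qed.

Lemma rank_le_size : n <= m.
Proof.
rewrite /m encode_extend size_cat; apply: leq_trans (leq_addl _ _).
rewrite size_flatten_iota -[leqLHS]muln1 -[X in X * _]card_ord -sum_nat_const.
apply: leq_sum => i _.
rewrite size_flatten_iota (bigD1 i) //=; apply: leq_trans (leq_addr _ _).
by rewrite size_flatten_iota (bigD1 i).
Qed.

(** The layout that [table], [unit_coord] and [zero_coord] read. *)
Definition coordinates (t : nat) : int :=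
  if t is t'.+1 then
    if t' < n ^ 3 then A (t' %/ n %/ n) (t' %/ n %% n) (t' %% n)
    else if t' < n ^ 3 + n then extend 0%R (u 0%R) (t' - n ^ 3)
    else extend 0%R (v 0%R) (t' - (n ^ 3 + n))
  else n.

Lemma verifier_complete :
    is_order_table a u -> evalv a u f v = 0%R ->
    m < Q.[m]%R -> (forall k, absz (u 0%R k) < 2 ^ Q.[m]%R) ->
    (forall k, absz (v 0%R k) < 2 ^ Q.[m]%R) ->
  exists2 w, size w = m + (1 + n ^ 3 + n + n) * Q.[m]%R.+1 & verifier Q f (encode_input a) w.
Proof.
move=> Hu Hv lt_m Hsu Hsv; set x := encode_input a.
pose zs := mkseq coordinates (1 + n ^ 3 + n + n).
have size_zs : size zs = 1 + n ^ 3 + n + n by rewrite size_mkseq.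
have ext_small k (g : 'I_n -> int) t : (forall i, absz (g i) < 2 ^ k) ->
    absz (extend 0%R g t) < 2 ^ k.
  by move=> Hg; rewrite /extend; case: insub => [i|]; rewrite ?Hg // absz0 expn_gt0.
have Hle : 2 ^ m <= 2 ^ Q.[m]%R by rewrite leq_exp2l // ltnW.
have zs_small z : z \in zs -> absz z < 2 ^ Q.[size x]%R.
  case/mapP=> t _ ->; rewrite /coordinates -/m; case: t => [|t].
    by rewrite absz_nat; apply: leq_trans Hle; apply: leq_ltn_trans rank_le_size (ltn_expl _ _).
  case: ifP => _; last by case: ifP => _; apply: ext_small.
  rewrite /A; apply: (ext_small) => i; apply: (ext_small) => j; apply: (ext_small) => k.
  exact: leq_trans (entry_lt _ _ _) Hle.
pose w := make_certificate (size x) n Q.[size x]%R zs.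
have Er : rank x w = n := rank_certificate Q zs rank_le_size.
have Ei t : t < 1 + n ^ 3 + n + n -> integer Q x w t = coordinates t.
  by move=> lt_t; rewrite (integer_certificate n zs_small) ?size_zs // nth_mkseq.
have lt_idx (i j k : 'I_n) : (i * n + j) * n + k < n ^ 3.
  by have := ltn_ord i; have := ltn_ord j; have := ltn_ord k; rewrite !expnS expn0; nia.
have Et (i j k : 'I_n) : table Q x w i j k = a i j k.
  rewrite /table Er Ei; last by have := lt_idx i j k; lia.
  have n_gt0 : 0 < n by apply: leq_ltn_trans (ltn_ord i).
  rewrite /= lt_idx modnMDl divnMDl // (modn_small (ltn_ord k)) (divn_small (ltn_ord k)) addn0.
  rewrite modnMDl divnMDl // (modn_small (ltn_ord j)) (divn_small (ltn_ord j)).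
  by rewrite addn0 extend_table.
have Eu (k : 'I_n) : unit_coord Q x w k = u 0%R k.
  rewrite /unit_coord Er Ei; last by have := ltn_ord k; lia.
  by rewrite -addnA add1n /= ltnNge leq_addr /= ltn_add2l ltn_ord addKn extendE.
have Ez (k : 'I_n) : zero_coord Q x w k = v 0%R k.
  rewrite /zero_coord Er Ei; last by have := ltn_ord k; lia.
  rewrite -!addnA add1n /= ltnNge leq_addr /= ltnNge addnA leq_addr /=.
  by rewrite addKn extendE.
have Em : magnitude Q x w 0 = n.
  by rewrite (magnitude_certificate n zs_small) ?size_zs ?nth_mkseq ?absz_nat.
have Ea : (fun i j k : 'I_n => table Q x w i j k) = a.
  by do 3![apply: functional_extensionality => ?]; apply: Et.
exists w; first by rewrite size_certificate size_zs.
apply/and3P; split; rewrite ?Em ?Er //; first by rewrite -encode_inputE Ea.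
apply/validP; rewrite Ea.
have -> : (\row_(k < n) unit_coord Q x w k = u)%R by apply/rowP => k; rewrite mxE Eu.
by have -> : (\row_(k < n) zero_coord Q x w k = v)%R by apply/rowP => k; rewrite mxE Ez.
Qed.

End Complete.

Theorem theorem2 (f : {poly int}) :
  separable_int_poly f -> NP (root_problem f).
Proof.
move=> sep_f; have [Q0 HQ0] := order_zero_size sep_f.
have [Q1 HQ1] := order_zero_size separable_linear.
pose Q : {poly nat} := ('X + Q0 + Q1 + 1%:P)%R.
have EQ m : Q.[m]%R = (m + Q0.[m]%R + Q1.[m]%R + 1)%N by rewrite !hornerE.
have [p Hp] : poly_bounded (fun m => m + (1 + m ^ 3 + m + m) * Q.[m]%R.+1).
  have HQ : poly_bounded (fun m => Q.[m]%R) by exists Q.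
  by poly_bound.
exists (verifier Q f), p; split; first exact: poly_time_verifier.
move=> x; split=> [/root_problemP[n [a [u [v [-> Hu Hv]]]]]|[u _ /verifier_sound//]].
set m := size (encode_input a).
have le_n : n <= m := rank_le_size a.
have norm_le (z : int) k : (`|z| <= 2 ^+ k)%R = (absz z <= 2 ^ k).
  by rewrite -abszE -natrX natz lez_nat.
have Ha i j k : (`|a i j k| <= 2 ^+ m)%R by rewrite norm_le ltnW // entry_lt.
have small (y : 'rV[int]_n) k : mx_size_le y k -> k < Q.[m]%R ->
    forall i, absz (y 0%R i) < 2 ^ Q.[m]%R.
  move=> Hy lt_k i; have := Hy 0%R i; rewrite norm_le => /leq_ltn_trans; apply.
  by rewrite ltn_exp2l.
have [|||w size_w ver] := verifier_complete (Q := Q) Hu Hv _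
  (small _ _ (HQ1 _ _ _ _ _ le_n Ha Hu (evalv_unit Hu)) _)
  (small _ _ (HQ0 _ _ _ _ _ le_n Ha Hu Hv) _).
1,2,3: by rewrite -/m EQ; lia.
exists w => //; rewrite size_w; apply: leq_trans (Hp _).
rewrite -/m leq_add2l leq_mul2r; apply/orP; right.
by rewrite !leq_add // leq_exp2r.
Qed.
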